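(* Let $\mathcal{D}$ be a triangulated category with arbitrary coproducts and a compatible closed symmetric monoidal structure with unit $S$, such that $R=\pi_*S$ is commutative and concentrated in degree zero. Let $I$ be a finitely generated ideal of $R$ such that $I\cap\operatorname{ann} I=0$. Then $\mathcal{GH}_{\mathbf{thick}\langle S/I\rangle}$ is true if and only if $R=I\times R/I$ as a direct product of rings and $R/I$ is von Neumann regular.
   Context: Write $\wedge$ for the monoidal product (exact in each variable) and $\pi_iX=\operatorname{Hom}_{\mathcal{D}}(\Sigma^iS,X)$, $\pi_*X=\bigoplus_i\pi_iX$. For $x\in R=\pi_0S$, $S/x$ is the cofiber of $x:S\to S$; for a finitely generated ideal $I=(x_1,\dots,x_n)$, $S/I=S/x_1\wedge\cdots\wedge S/x_n$. The object $S/I$ depends on the chosen generators, but the thick subcategory $\mathbf{thick}\langle S/I\rangle$ does not. Here $\mathbf{thick}\langle Z\rangle$ is the smallest class of objects containing $Z$ and closed under (de)suspension, retracts and cofiber sequences (two-out-of-three in exact triangles). For a class $\mathcal{C}$ of objects, $\mathcal{GH}_{\mathcal{C}}$ is the statement: if $f:X\to Y$ is a morphism between objects of $\mathcal{C}$ and $\pi_*f=0$, then $f=0$. For an ideal $I$, $\operatorname{ann}I=\{r\in R: rI=0\}$. ''$R=I\times R/I$ as a direct product of rings'' means that $I$ is a ring direct factor of $R$, i.e. $I=eR$ for an idempotent $e\in R$. A ring $T$ is von Neumann regular if for every $x\in T$ there is $y\in T$ with $xyx=x$. *)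

(* Defs.v *)
From HB Require Import structures.
From mathcomp Require Import all_boot all_order all_algebra.
From mathcomp Require Import boolp.

Set Implicit Arguments.
Unset Strict Implicit.
Unset Printing Implicit Defensive.

Import GRing.Theory.
Local Open Scope ring_scope.
Local Open Scope quotient_scope.

Record additiveCat := AdditiveCat {
  obj :> Type;
  mor : obj -> obj -> zmodType;
  idm : forall X, mor X X;
  compm : forall X Y Z, mor Y Z -> mor X Y -> mor X Z;
  compmA : forall X Y Z W (h : mor Z W) (g : mor Y Z) (f : mor X Y),
    compm h (compm g f) = compm (compm h g) f;
  comp1m : forall X Y (f : mor X Y), compm (idm Y) f = f;
  compm1 : forall X Y (f : mor X Y), compm f (idm X) = f;
  compmDl : forall X Y Z (g g' : mor Y Z) (f : mor X Y),
    compm (g + g') f = compm g f + compm g' f;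
  compmDr : forall X Y Z (g : mor Y Z) (f f' : mor X Y),
    compm g (f + f') = compm g f + compm g f';
  zero_object_ex : exists Z, idm Z = 0;
  biproduct_ex : forall X Y,
    exists B (i1 : mor X B) (i2 : mor Y B) (p1 : mor B X) (p2 : mor B Y),
      [/\ compm p1 i1 = idm X, compm p2 i2 = idm Y,
          compm p1 i2 = 0, compm p2 i1 = 0
        & compm i1 p1 + compm i2 p2 = idm B]
}.

Arguments mor {a} X Y.
Arguments idm {a} X.
Arguments compm {a X Y Z} g f.

Declare Scope cat_scope.
Delimit Scope cat_scope with cat.
Local Open Scope cat_scope.

Notation "g '\;;' f" := (compm g f)
  (at level 40, left associativity, format "g  '\;;'  f") : cat_scope.

Record iso (C : additiveCat) (X Y : C) := Iso {
  fwd : mor X Y;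
  bwd : mor Y X;
  fwdK : bwd \;; fwd = idm X;
  bwdK : fwd \;; bwd = idm Y
}.

Record additiveFunctor (C : additiveCat) := AdditiveFunctor {
  fobj :> C -> C;
  fmap : forall X Y : C, mor X Y -> mor (fobj X) (fobj Y);
  fmap1 : forall X, fmap (idm X) = idm (fobj X);
  fmap_comp : forall X Y Z (g : mor Y Z) (f : mor X Y),
    fmap (g \;; f) = fmap g \;; fmap f;
  fmapD : forall X Y (f f' : mor X Y), fmap (f + f') = fmap f + fmap f'
}.

Definition has_coproducts (C : additiveCat) : Prop :=
  forall (J : Type) (X : J -> C),
    exists (P : C) (inj : forall j, mor (X j) P),
      forall (Y : C) (f : forall j, mor (X j) Y),
        exists! g : mor P Y, forall j, g \;; inj j = f j.

Record triangulation (C : additiveCat) := Triangulation {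
  susp : additiveFunctor C;
  desusp : additiveFunctor C;
  suspK : forall X : C, iso (susp (desusp X)) X;
  suspK_nat : forall (X Y : C) (f : mor X Y),
    f \;; fwd (suspK X) = fwd (suspK Y) \;; fmap susp (fmap desusp f);
  desuspK : forall X : C, iso (desusp (susp X)) X;
  desuspK_nat : forall (X Y : C) (f : mor X Y),
    f \;; fwd (desuspK X) = fwd (desuspK Y) \;; fmap desusp (fmap susp f);

  (* [dist f g h]: the triangle X -f-> Y -g-> Z -h-> susp X is exact *)
  dist : forall X Y Z : C, mor X Y -> mor Y Z -> mor Z (susp X) -> Prop;

  dist_iso : forall (X Y Z X' Y' Z' : C)
      (f : mor X Y) (g : mor Y Z) (h : mor Z (susp X))
      (f' : mor X' Y') (g' : mor Y' Z') (h' : mor Z' (susp X'))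
      (u : iso X X') (v : iso Y Y') (w : iso Z Z'),
    fwd v \;; f = f' \;; fwd u ->
    fwd w \;; g = g' \;; fwd v ->
    fmap susp (fwd u) \;; h = h' \;; fwd w ->
    dist f g h -> dist f' g' h';
  dist_id : forall X Z : C, idm Z = 0 ->
    dist (idm X) (0 : mor X Z) (0 : mor Z (susp X));
  dist_cone : forall (X Y : C) (f : mor X Y),
    exists (Z : C) (g : mor Y Z) (h : mor Z (susp X)), dist f g h;
  dist_rot : forall (X Y Z : C)
      (f : mor X Y) (g : mor Y Z) (h : mor Z (susp X)),
    dist f g h <-> dist g h (- fmap susp f);
  dist_fill : forall (X Y Z X' Y' Z' : C)
      (f : mor X Y) (g : mor Y Z) (h : mor Z (susp X))
      (f' : mor X' Y') (g' : mor Y' Z') (h' : mor Z' (susp X'))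
      (u : mor X X') (v : mor Y Y'),
    dist f g h -> dist f' g' h' -> v \;; f = f' \;; u ->
    exists w : mor Z Z', w \;; g = g' \;; v /\ fmap susp u \;; h = h' \;; w;
  dist_octahedron : forall (X Y Z U V W : C) (f : mor X Y) (g : mor Y Z)
      (a : mor Y U) (b : mor U (susp X))
      (c : mor Z V) (d : mor V (susp Y))
      (p : mor Z W) (q : mor W (susp X)),
    dist f a b -> dist g c d -> dist (g \;; f) p q ->
    exists (u : mor U W) (v : mor W V),
      dist u v (fmap susp a \;; d) /\
      [/\ u \;; a = p \;; g, q \;; u = b, v \;; p = c
        & d \;; v = fmap susp f \;; q]
}.

Arguments suspK {C} t X.
Arguments desuspK {C} t X.
Arguments dist {C} t {X Y Z} f g h.

Definition is_cofiber (C : additiveCat) (T : triangulation C)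
    (X Y : C) (f : mor X Y) (Z : C) : Prop :=
  exists (g : mor Y Z) (h : mor Z (susp T X)), dist T f g h.

Definition shift (C : additiveCat) (T : triangulation C) (i : int) (X : C)
    : C :=
  match i with
  | Posz n => iter n (susp T) X
  | Negz n => iter n.+1 (desusp T) X
  end.

Section Thick.
Variables (C : additiveCat) (T : triangulation C) (A : C).

Inductive thick : C -> Prop :=
| thick_gen : thick A
| thick_susp X : thick X -> thick (susp T X)
| thick_desusp X : thick X -> thick (desusp T X)
| thick_retract (X Y : C) (i : mor X Y) (r : mor Y X) :
    r \;; i = idm X -> thick Y -> thick X
| thick_dist1 (X Y Z : C) (f : mor X Y) (g : mor Y Z) (h : mor Z (susp T X)) :
    dist T f g h -> thick Y -> thick Z -> thick X
| thick_dist2 (X Y Z : C) (f : mor X Y) (g : mor Y Z) (h : mor Z (susp T X)) :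
    dist T f g h -> thick X -> thick Z -> thick Y
| thick_dist3 (X Y Z : C) (f : mor X Y) (g : mor Y Z) (h : mor Z (susp T X)) :
    dist T f g h -> thick X -> thick Y -> thick Z.

End Thick.

Record closedSymMonoidal (C : additiveCat) := ClosedSymMonoidal {
  sunit : C;
  smash : C -> C -> C;
  smash_map : forall X X' Y Y' : C,
    mor X X' -> mor Y Y' -> mor (smash X Y) (smash X' Y');
  smash_map1 : forall X Y, smash_map (idm X) (idm Y) = idm (smash X Y);
  smash_map_comp : forall (X X' X'' Y Y' Y'' : C)
      (f' : mor X' X'') (f : mor X X') (g' : mor Y' Y'') (g : mor Y Y'),
    smash_map (f' \;; f) (g' \;; g) = smash_map f' g' \;; smash_map f g;

  assoc : forall X Y Z : C, iso (smash (smash X Y) Z) (smash X (smash Y Z));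
  assoc_nat : forall (X X' Y Y' Z Z' : C)
      (f : mor X X') (g : mor Y Y') (h : mor Z Z'),
    fwd (assoc X' Y' Z') \;; smash_map (smash_map f g) h =
    smash_map f (smash_map g h) \;; fwd (assoc X Y Z);
  lunit : forall X : C, iso (smash sunit X) X;
  lunit_nat : forall (X X' : C) (f : mor X X'),
    fwd (lunit X') \;; smash_map (idm sunit) f = f \;; fwd (lunit X);
  runit : forall X : C, iso (smash X sunit) X;
  runit_nat : forall (X X' : C) (f : mor X X'),
    fwd (runit X') \;; smash_map f (idm sunit) = f \;; fwd (runit X);
  pentagon : forall X Y Z W : C,
    fwd (assoc X Y (smash Z W)) \;; fwd (assoc (smash X Y) Z W) =
    smash_map (idm X) (fwd (assoc Y Z W)) \;; fwd (assoc X (smash Y Z) W)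
      \;; smash_map (fwd (assoc X Y Z)) (idm W);
  unit_triangle : forall X Y : C,
    smash_map (idm X) (fwd (lunit Y)) \;; fwd (assoc X sunit Y) =
    smash_map (fwd (runit X)) (idm Y);

  twist : forall X Y : C, mor (smash X Y) (smash Y X);
  twist_nat : forall (X X' Y Y' : C) (f : mor X X') (g : mor Y Y'),
    twist X' Y' \;; smash_map f g = smash_map g f \;; twist X Y;
  twistK : forall X Y : C, twist Y X \;; twist X Y = idm (smash X Y);
  hexagon : forall X Y Z : C,
    fwd (assoc Y Z X) \;; twist X (smash Y Z) \;; fwd (assoc X Y Z) =
    smash_map (idm Y) (twist X Z) \;; fwd (assoc Y X Z)
      \;; smash_map (twist X Y) (idm Z);

  ihom : C -> C -> C;
  ev : forall X Y : C, mor (smash (ihom X Y) X) Y;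
  curry : forall X Y Z : C, mor (smash Z X) Y -> mor Z (ihom X Y);
  curryK : forall (X Y Z : C) (f : mor (smash Z X) Y),
    ev X Y \;; smash_map (curry f) (idm X) = f;
  evK : forall (X Y Z : C) (g : mor Z (ihom X Y)),
    curry (ev X Y \;; smash_map g (idm X)) = g
}.

Arguments smash_map {C} c {X X' Y Y'} f g.
Arguments twist {C} c X Y.
Arguments ev {C} c X Y.
Arguments curry {C} c {X Y Z} f.

Section InternalHom.
Variables (C : additiveCat) (M : closedSymMonoidal C).

Definition ihom_postcomp (W X Y : C) (f : mor X Y) :
    mor (ihom M W X) (ihom M W Y) :=
  curry M (f \;; ev M W X).

Definition ihom_precomp (W X Y : C) (f : mor X Y) :
    mor (ihom M Y W) (ihom M X W) :=
  curry M (ev M Y W \;; smash_map M (idm (ihom M Y W)) f).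

End InternalHom.

Section SuspensionOfInternalHom.
Variables (C : additiveCat) (T : triangulation C) (M : closedSymMonoidal C).
Variable e : forall X Y : C,
  iso (smash M (susp T X) Y) (susp T (smash M X Y)).

(* susp F(W, X) -> F(W, susp X), adjoint to
   susp F(W, X) /\ W -> susp (F(W, X) /\ W) -> susp X *)
Definition susp_ihom (W X : C) :
    mor (susp T (ihom M W X)) (ihom M W (susp T X)) :=
  curry M (fmap (susp T) (ev M W X) \;; fwd (e (ihom M W X) W)).

(* With A := desusp F(X, W), the map A -> F(susp X, W) adjoint to
   A /\ susp X -> susp X /\ A -> susp (X /\ A) -> susp (A /\ X)
     -> susp A /\ X -> F(X, W) /\ X -> W *)
Definition desusp_ihom (X W : C) :
    mor (desusp T (ihom M X W)) (ihom M (susp T X) W) :=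
  let A := desusp T (ihom M X W) in
  curry M (ev M X W
    \;; smash_map M (fwd (suspK T (ihom M X W))) (idm X)
    \;; bwd (e A X)
    \;; fmap (susp T) (twist M X A)
    \;; fwd (e X A)
    \;; twist M A (susp T X)).

End SuspensionOfInternalHom.

(* Compatibility in the sense of Hovey, Palmieri and Strickland, Axiomatic
   stable homotopy theory, Appendix A.2.  Their graded commutativity axiom is
   stated for r = s = 1 only, where it says that the twist of S^1 /\ S^1 is
   -1; the case of S^r /\ S^s follows from this one. *)
Record compatible (C : additiveCat)
    (T : triangulation C) (M : closedSymMonoidal C) := Compatible {
  smash_susp : forall X Y : C,
    iso (smash M (susp T X) Y) (susp T (smash M X Y));
  smash_susp_nat : forall (X X' Y Y' : C) (f : mor X X') (g : mor Y Y'),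
    fwd (smash_susp X' Y') \;; smash_map M (fmap (susp T) f) g =
    fmap (susp T) (smash_map M f g) \;; fwd (smash_susp X Y);
  smash_susp_runit : forall X : C,
    fmap (susp T) (fwd (runit M X)) \;; fwd (smash_susp X (sunit M)) =
    fwd (runit M (susp T X));
  smash_susp_assoc : forall X Y Z : C,
    fwd (smash_susp X (smash M Y Z)) \;; fwd (assoc M (susp T X) Y Z) =
    fmap (susp T) (fwd (assoc M X Y Z)) \;; fwd (smash_susp (smash M X Y) Z)
      \;; smash_map M (fwd (smash_susp X Y)) (idm Z);
  smash_exact : forall (X Y Z W : C)
      (f : mor X Y) (g : mor Y Z) (h : mor Z (susp T X)),
    dist T f g h ->
    dist T (smash_map M f (idm W)) (smash_map M g (idm W))
           (fwd (smash_susp X W) \;; smash_map M h (idm W));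
  ihom_exact_right : forall (X Y Z W : C)
      (f : mor X Y) (g : mor Y Z) (h : mor Z (susp T X)),
    dist T f g h ->
    exists k : mor (ihom M W Z) (susp T (ihom M W X)),
      susp_ihom smash_susp W X \;; k = ihom_postcomp M W h /\
      dist T (ihom_postcomp M W f) (ihom_postcomp M W g) k;
  (* exactness of
     desusp F(X, W) -(-F(h, W))-> F(Z, W) -> F(Y, W) -> F(X, W) *)
  ihom_exact_left : forall (X Y Z W : C)
      (f : mor X Y) (g : mor Y Z) (h : mor Z (susp T X)),
    dist T f g h ->
    dist T (- (ihom_precomp M W h \;; desusp_ihom smash_susp X W))
           (ihom_precomp M W g)
           (bwd (suspK T (ihom M X W)) \;; ihom_precomp M W f);
  twist_sphere :
    twist M (susp T (sunit M)) (susp T (sunit M)) =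
    - idm (smash M (susp T (sunit M)) (susp T (sunit M)))
}.

Definition endo (C : additiveCat) (X : C) : Type := mor X X.

Section Endo.
Variables (C : additiveCat) (X : C).

HB.instance Definition _ := GRing.Zmodule.copy (endo X) (mor X X).

Let endo_mul (f g : endo X) : endo X := compm f g.
Fact endo_mulA : associative endo_mul.
Proof. by move=> f g h; apply: compmA. Qed.
Fact endo_mul1r : left_id (idm X : endo X) endo_mul.
Proof. by move=> f; apply: comp1m. Qed.
Fact endo_mulr1 : right_id (idm X : endo X) endo_mul.
Proof. by move=> f; apply: compm1. Qed.
Fact endo_mulDl : left_distributive endo_mul +%R.
Proof. by move=> f g h; apply: compmDl. Qed.
Fact endo_mulDr : right_distributive endo_mul +%R.
Proof. by move=> f g h; apply: compmDr. Qed.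

HB.instance Definition _ := GRing.Zmodule_isPzRing.Build (endo X)
  endo_mulA endo_mul1r endo_mulr1 endo_mulDl endo_mulDr.

End Endo.

Definition htpy (C : additiveCat) (T : triangulation C)
    (M : closedSymMonoidal C) (i : int) (X : C) : zmodType :=
  mor (shift T i (sunit M)) X.

(* Convertible, as a type, to [htpy T M 0 (sunit M)]. *)
Definition unit_ring (C : additiveCat) (M : closedSymMonoidal C) : pzRingType :=
  endo (sunit M).

Definition htpy_unit_concentrated (C : additiveCat) (T : triangulation C)
    (M : closedSymMonoidal C) : Prop :=
  forall i : int, i != 0 -> forall a : htpy T M i (sunit M), a = 0.

Definition generating_hypothesis (C : additiveCat) (T : triangulation C)
    (M : closedSymMonoidal C) (P : C -> Prop) : Prop :=
  forall (X Y : C) (f : mor X Y), P X -> P Y ->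
    (forall (i : int) (a : htpy T M i X), f \;; a = 0) -> f = 0.

Record ideal (R : pzRingType) := Ideal {
  mem_ideal :> R -> Prop;
  ideal0 : mem_ideal 0;
  idealB : forall x y, mem_ideal x -> mem_ideal y -> mem_ideal (x - y);
  idealMl : forall r x, mem_ideal x -> mem_ideal (r * x);
  idealMr : forall r x, mem_ideal x -> mem_ideal (x * r)
}.

(* For commutative [R]; left linear combinations of the [x i]. *)
Definition generated_by (R : pzRingType) (I : ideal R)
    (n : nat) (x : 'I_n -> R) : Prop :=
  forall r, I r <-> exists a : 'I_n -> R, r = \sum_(i < n) a i * x i.

Definition annihilator (R : pzRingType) (I : ideal R) (r : R) : Prop :=
  forall y, I y -> r * y = 0.

Definition ring_direct_factor (R : pzRingType) (I : ideal R) : Prop :=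
  exists e : R, e * e = e /\ forall r, I r <-> exists s, r = e * s.

Definition von_neumann_regular (R : pzRingType) : Prop :=
  forall x : R, exists y : R, x * y * x = x.

(* The library's [{ideal_quot _}] excludes the improper ideal. *)
Section QuotientRing.
Variables (R : pzRingType) (I : ideal R).

Definition congr_ideal (x y : R) : bool := `[< I (x - y) >].

Fact congr_ideal_refl : reflexive congr_ideal.
Proof. by move=> x; apply/asboolP; rewrite subrr; apply: ideal0. Qed.
Fact congr_ideal_sym : symmetric congr_ideal.
Proof.
by move=> x y; apply/asboolP/asboolP => h; rewrite -opprB -sub0r;
  apply: idealB => //; apply: ideal0.
Qed.
Fact congr_ideal_trans : transitive congr_ideal.
Proof.
move=> y x z /asboolP xy /asboolP yz; apply/asboolP.
have -> : x - z = (x - y) - (0 - (y - z)) by rewrite sub0r opprK addrA subrK.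
by do 2![apply: idealB => //]; apply: ideal0.
Qed.

Canonical congr_ideal_equiv :=
  EquivRel congr_ideal congr_ideal_refl congr_ideal_sym congr_ideal_trans.

Definition ring_quot := {eq_quot congr_ideal}.
HB.instance Definition _ : EqQuotient R congr_ideal ring_quot :=
  EqQuotient.on ring_quot.
HB.instance Definition _ := Choice.on ring_quot.

Let Q := ring_quot.

Lemma eq_ring_quot (x y : R) : I (x - y) <-> \pi_Q x = \pi_Q y.
Proof.
split=> [h | /eqmodP /asboolP //].
by apply/eqmodP; apply/asboolP.
Qed.

Definition ring_quot_opp (x : Q) : Q := \pi_Q (- repr x).
Definition ring_quot_add (x y : Q) : Q := \pi_Q (repr x + repr y).
Definition ring_quot_mul (x y : Q) : Q := \pi_Q (repr x * repr y).

Lemma ring_quot_repr (x : R) : I (repr (\pi_Q x) - x).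
Proof. by apply/eq_ring_quot; rewrite reprK. Qed.

Lemma ring_quot_oppE x : ring_quot_opp (\pi_Q x) = \pi_Q (- x).
Proof.
apply/eq_ring_quot; rewrite opprK addrC -[x - _]opprB -sub0r.
by apply: idealB; [apply: ideal0 | apply: ring_quot_repr].
Qed.

Lemma idealD x y : I x -> I y -> I (x + y).
Proof.
move=> hx hy; rewrite -[y]opprK -[- y]sub0r.
by do 2![apply: idealB => //]; apply: ideal0.
Qed.

Lemma ring_quot_addE x y :
  ring_quot_add (\pi_Q x) (\pi_Q y) = \pi_Q (x + y).
Proof.
by apply/eq_ring_quot; rewrite opprD addrACA; apply: idealD;
  apply: ring_quot_repr.
Qed.

Lemma ring_quot_mulE x y :
  ring_quot_mul (\pi_Q x) (\pi_Q y) = \pi_Q (x * y).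
Proof.
apply/eq_ring_quot; set x' := repr _; set y' := repr _.
have -> : x' * y' - x * y = (x' - x) * y' + x * (y' - y).
  by rewrite mulrBl mulrBr addrA subrK.
by apply: idealD; [apply: idealMr | apply: idealMl]; apply: ring_quot_repr.
Qed.

Fact ring_quot_addA : associative ring_quot_add.
Proof.
elim/quotW=> x; elim/quotW=> y; elim/quotW=> z.
by rewrite (ring_quot_addE y z) (ring_quot_addE x y) 2!ring_quot_addE addrA.
Qed.
Fact ring_quot_addC : commutative ring_quot_add.
Proof. by elim/quotW=> x; elim/quotW=> y; rewrite !ring_quot_addE addrC. Qed.
Fact ring_quot_add0 : left_id (\pi_Q 0) ring_quot_add.
Proof. by elim/quotW=> x; rewrite ring_quot_addE add0r. Qed.
Fact ring_quot_addN : left_inverse (\pi_Q 0) ring_quot_opp ring_quot_add.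
Proof.
by elim/quotW=> x; rewrite ring_quot_oppE ring_quot_addE addNr.
Qed.

HB.instance Definition _ := GRing.isZmodule.Build ring_quot
  ring_quot_addA ring_quot_addC ring_quot_add0 ring_quot_addN.

Fact ring_quot_mulA : associative ring_quot_mul.
Proof.
elim/quotW=> x; elim/quotW=> y; elim/quotW=> z.
by rewrite (ring_quot_mulE y z) (ring_quot_mulE x y) 2!ring_quot_mulE mulrA.
Qed.
Fact ring_quot_mul1r : left_id (\pi_Q 1) ring_quot_mul.
Proof. by elim/quotW=> x; rewrite ring_quot_mulE mul1r. Qed.
Fact ring_quot_mulr1 : right_id (\pi_Q 1) ring_quot_mul.
Proof. by elim/quotW=> x; rewrite ring_quot_mulE mulr1. Qed.
Fact ring_quot_mulDl : left_distributive ring_quot_mul ring_quot_add.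
Proof.
elim/quotW=> x; elim/quotW=> y; elim/quotW=> z.
rewrite (ring_quot_addE x y) (ring_quot_mulE x z) (ring_quot_mulE y z).
by rewrite ring_quot_mulE ring_quot_addE mulrDl.
Qed.
Fact ring_quot_mulDr : right_distributive ring_quot_mul ring_quot_add.
Proof.
elim/quotW=> x; elim/quotW=> y; elim/quotW=> z.
rewrite (ring_quot_addE y z) (ring_quot_mulE x y) (ring_quot_mulE x z).
by rewrite ring_quot_mulE ring_quot_addE mulrDr.
Qed.

HB.instance Definition _ := GRing.Zmodule_isPzRing.Build ring_quot
  ring_quot_mulA ring_quot_mul1r ring_quot_mulr1
  ring_quot_mulDl ring_quot_mulDr.

End QuotientRing.

(* Main.v *)
Require Import Defs.
From HB Require Import structures.
From mathcomp Require Import all_boot all_order all_algebra.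
From mathcomp Require Import ring.
Set Implicit Arguments.
Unset Strict Implicit.
Unset Printing Implicit Defensive.
Import Order.TTheory GRing.Theory Num.Theory.
Local Open Scope ring_scope.
Local Open Scope cat_scope.

(** Every element [r] of [R = pi_0 S] acts on every object [X], naturally in
    [X] (section [Action]), and [S/x /\ X] is the cofiber of [x] on [X]
    ([smash_cofiber]).  As [pi_* S] lives in degree zero, spheres of different
    dimensions have no nonzero maps between them.

    Suppose that [I = eR] with [e] idempotent and that [R/I] is von Neumann
    regular.  Powers of the generators of [I] annihilate [S/I], hence so does
    [e].  Consider the objects that are annihilated by [e] and are retracts of
    finite sums of spheres.  A map between two of them is a matrix over the
    regular ring [R/I], so it has a pseudo-inverse [g], that is [f g f = f]
    ([spherical_regular]); this makes its cofiber a retract of a finite sum of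
    spheres again ([cofiber_regular]).  Such objects therefore form a thick
    class ([split_thick]).  It contains [S/e], hence [S/e /\ S/I], hence the
    retract [S/I] ([split_koszul]).  So every object of [thick S/I] is a
    retract of a sum of spheres, and on such objects a map that vanishes on
    homotopy is zero.

    Conversely, assume the generating hypothesis on [thick S/I].  It contains
    the Koszul object [K] on the squares [x_i^2] of the generators.  For [c] in
    [I], consider the composite of the collapse of [K] onto its top cell [S^n],
    of [c], and of the inclusion of the bottom cell into [Sigma^n K].  On
    homotopy the collapse takes values annihilated by powers of the [x_i],
    hence, as [I] meets its annihilator trivially, annihilated by [I]: the
    composite vanishes on homotopy, so it is zero.  An obstruction argument
    along the cells shows that it is zero only if [c] lies in the ideal of the
    [x_i^2] ([koszul_ghost]).  So [I] equals its square, and Nakayama's lemma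
    makes it [eR] for an idempotent [e] ([idempotent_generator]).  For [x] in
    [R], the cofiber of [y = e + (1 - e) x] is annihilated by [e] and belongs to
    [thick S/I].  A map from this cofiber to itself shows that [yR] meets the
    annihilator of [y] trivially ([cofiber_gh_reduced]), so the first step
    applies to the ideal [yR] too and puts [y] in [y^2 R]; modulo [e] this is
    the regularity of [x]. *)

(** * Additive categories *)

Section AdditiveCategory.
Variable C : additiveCat.
Implicit Types X Y Z : C.

Lemma comp0m X Y Z (f : mor X Y) : (0 : mor Y Z) \;; f = 0.
Proof. by apply: (addrI (0 \;; f)); rewrite -compmDl !addr0. Qed.

Lemma compm0 X Y Z (g : mor Y Z) : g \;; (0 : mor X Y) = 0.
Proof. by apply: (addrI (g \;; 0)); rewrite -compmDr !addr0. Qed.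

Lemma compNm X Y Z (g : mor Y Z) (f : mor X Y) : - g \;; f = - (g \;; f).
Proof. by apply: (addrI (g \;; f)); rewrite -compmDl !subrr comp0m. Qed.

Lemma compmN X Y Z (g : mor Y Z) (f : mor X Y) : g \;; - f = - (g \;; f).
Proof. by apply: (addrI (g \;; f)); rewrite -compmDr !subrr compm0. Qed.

Lemma compmBl X Y Z (g g' : mor Y Z) (f : mor X Y) :
  (g - g') \;; f = g \;; f - g' \;; f.
Proof. by rewrite compmDl compNm. Qed.

Lemma compmBr X Y Z (g : mor Y Z) (f f' : mor X Y) :
  g \;; (f - f') = g \;; f - g \;; f'.
Proof. by rewrite compmDr compmN. Qed.

Lemma fmap0 (F : additiveFunctor C) X Y : fmap F (0 : mor X Y) = 0.
Proof. by apply: (addrI (fmap F 0)); rewrite -fmapD !addr0. Qed.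

Lemma fmapN (F : additiveFunctor C) X Y (f : mor X Y) :
  fmap F (- f) = - fmap F f.
Proof. by apply: (addrI (fmap F f)); rewrite -fmapD !subrr fmap0. Qed.

Lemma fmapB (F : additiveFunctor C) X Y (f f' : mor X Y) :
  fmap F (f - f') = fmap F f - fmap F f'.
Proof. by rewrite fmapD fmapN. Qed.

Definition iso_sym X Y (u : iso X Y) : iso Y X := Iso (bwdK u) (fwdK u).

Definition iso_refl X : iso X X := Iso (comp1m (idm X)) (comp1m (idm X)).

Lemma comp_iso_id X Y Z (a : mor X Y) (a' : mor Y X) (b : mor Y Z)
    (b' : mor Z Y) :
  a' \;; a = idm X -> b' \;; b = idm Y -> (a' \;; b') \;; (b \;; a) = idm X.
Proof.
by move=> aK bK; rewrite !compmA -[a' \;; b' \;; b]compmA bK compm1 aK.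
Qed.

Definition iso_trans X Y Z (u : iso X Y) (v : iso Y Z) : iso X Z :=
  Iso (comp_iso_id (fwdK u) (fwdK v)) (comp_iso_id (bwdK v) (bwdK u)).

Lemma fmap_iso_id (F : additiveFunctor C) X Y (f : mor X Y) (g : mor Y X) :
  g \;; f = idm X -> fmap F g \;; fmap F f = idm (F X).
Proof. by move=> gf; rewrite -fmap_comp gf fmap1. Qed.

Definition fmap_iso (F : additiveFunctor C) X Y (u : iso X Y) :
  iso (F X) (F Y) := Iso (fmap_iso_id F (fwdK u)) (fmap_iso_id F (bwdK u)).

Lemma comp_fwd_inj X Y Z (u : iso X Y) (f g : mor Y Z) :
  f \;; fwd u = g \;; fwd u -> f = g.
Proof.
by move=> fg; rewrite -[f]compm1 -[g]compm1 -(bwdK u) !compmA fg.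
Qed.

Lemma fwd_comp_inj X Y Z (u : iso Y Z) (f g : mor X Y) :
  fwd u \;; f = fwd u \;; g -> f = g.
Proof.
by move=> fg; rewrite -[f]comp1m -[g]comp1m -(fwdK u) -!compmA fg.
Qed.

Definition hom_zero X Y : Prop := forall f : mor X Y, f = 0.

Lemma hom_zero_iso X X' Y Y' (u : iso X X') (v : iso Y Y') :
  hom_zero X Y -> hom_zero X' Y'.
Proof.
move=> XY f; apply: (@comp_fwd_inj _ _ _ u).
apply: (@fwd_comp_inj _ _ _ (iso_sym v)).
by rewrite [LHS]XY comp0m compm0.
Qed.

(** * Regular morphisms *)

Definition regular X Y (f : mor X Y) : Prop :=
  exists g : mor Y X, f \;; g \;; f = f.

Lemma regular0 X Y : regular (0 : mor X Y).
Proof. by exists 0; rewrite compm0. Qed.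

(** McCoy's identity: a partial pseudo-inverse [g] of [f] is corrected by a
    pseudo-inverse [k] of the defect [f - f g f]. *)
Lemma mccoy_defect X Y (f : mor X Y) (g k : mor Y X) :
  let h := f - f \;; g \;; f in
  exists g' : mor Y X, h - h \;; k \;; h = f - f \;; g' \;; f.
Proof.
move=> h; exists (g + (idm X - g \;; f) \;; k \;; (idm Y - f \;; g)).
have hl : h = f \;; (idm X - g \;; f) by rewrite compmBr compm1 compmA.
have hr : h = (idm Y - f \;; g) \;; f by rewrite compmBl comp1m.
rewrite compmDr compmDl opprD addrA -/h {2}hl {2}hr; congr (_ - _).
by rewrite !compmA.
Qed.

End AdditiveCategory.

(** * Triangulated categories *)

Section Triangulated.
Variables (C : additiveCat) (T : triangulation C).
Local Notation Sg := (susp T).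
Implicit Types X Y Z A B : C.

Lemma desusp_inj X Y (f g : mor X Y) :
  fmap (desusp T) f = fmap (desusp T) g -> f = g.
Proof.
move=> fg; apply: (@comp_fwd_inj _ _ _ _ (suspK T X)).
by rewrite !suspK_nat fg.
Qed.

Lemma susp_inj X Y (f g : mor X Y) : fmap Sg f = fmap Sg g -> f = g.
Proof.
move=> fg; apply: (@comp_fwd_inj _ _ _ _ (desuspK T X)).
by rewrite !desuspK_nat fg.
Qed.

Lemma susp_full X Y (h : mor (Sg X) (Sg Y)) : exists f, h = fmap Sg f.
Proof.
exists (fwd (desuspK T Y) \;; fmap (desusp T) h \;; bwd (desuspK T X)).
apply: desusp_inj; apply: (@fwd_comp_inj _ _ _ _ (desuspK T Y)).
by rewrite -desuspK_nat -compmA fwdK compm1.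
Qed.

Lemma susp_eq0 X Y (f : mor X Y) : fmap Sg f = 0 -> f = 0.
Proof. by rewrite -(fmap0 Sg) => /susp_inj. Qed.

Lemma hom_zero_susp X Y : hom_zero (Sg X) (Sg Y) <-> hom_zero X Y.
Proof.
split=> XY f; first exact/susp_eq0/XY.
by have [g ->] := susp_full f; rewrite (XY g) fmap0.
Qed.

Lemma regular_susp X Y (f : mor X Y) : regular (fmap Sg f) <-> regular f.
Proof.
split=> -[g].
  by have [k ->] := susp_full g; rewrite -!fmap_comp => /susp_inj; exists k.
by move=> fgf; exists (fmap Sg g); rewrite -!fmap_comp fgf.
Qed.

Lemma regular_iso X X' Y Y' (u : iso X X') (v : iso Y Y') (f : mor X' Y') :
  regular (bwd v \;; f \;; fwd u) -> regular f.
Proof.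
case=> g fgf; exists (fwd u \;; g \;; bwd v).
apply: (@comp_fwd_inj _ _ _ _ u); apply: (@fwd_comp_inj _ _ _ _ (iso_sym v)).
by rewrite /= [RHS]compmA -[RHS]fgf !compmA.
Qed.

Fixpoint fmap_iter n X Y (f : mor X Y) : mor (iter n Sg X) (iter n Sg Y) :=
  if n is n'.+1 then fmap Sg (fmap_iter n' f) else f.

Lemma fmap_iter_comp n X Y Z (g : mor Y Z) (f : mor X Y) :
  fmap_iter n (g \;; f) = fmap_iter n g \;; fmap_iter n f.
Proof. by elim: n => //= n ->; rewrite fmap_comp. Qed.

Lemma fmap_iter_full n X Y (h : mor (iter n Sg X) (iter n Sg Y)) :
  exists f, h = fmap_iter n f.
Proof.
elim: n h => [|n IH] h /=; first by exists h.
by have [k ->] := susp_full h; have [f ->] := IH k; exists f.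
Qed.

Lemma fmap_iter_eq0 n X Y (f : mor X Y) : fmap_iter n f = 0 <-> f = 0.
Proof.
elim: n => //= n IH; split=> [/susp_eq0 /IH //|/IH ->].
exact: fmap0.
Qed.

Section Exactness.
Variables (X Y Z : C) (f : mor X Y) (g : mor Y Z) (h : mor Z (Sg X)).
Hypothesis fgh : dist T f g h.

Lemma dist_rotl : dist T g h (- fmap Sg f).
Proof. exact: (proj1 (dist_rot _ _ _) fgh). Qed.

Lemma dist_comp0 : g \;; f = 0.
Proof.
have [O O0] := zero_object_ex C.
have [w [<- _]] := dist_fill (dist_id T X O0) fgh (erefl (f \;; idm X)).
exact: compm0.
Qed.

Lemma dist_lift A (k : mor A Y) : g \;; k = 0 -> exists l, k = f \;; l.
Proof.
move=> gk; have [O O0] := zero_object_ex C.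
have idA := proj1 (dist_rot _ _ _) (dist_id T A O0).
have sq : (0 : mor O Z) \;; 0 = g \;; k by rewrite gk compm0.
have [w [_]] := dist_fill idA (proj1 (dist_rot _ _ _) fgh) sq.
have [l ->] := susp_full w.
rewrite fmap1 compmN compm1 compNm -fmap_comp => /oppr_inj /susp_inj.
by exists l.
Qed.

Lemma dist_extend B (k : mor Y B) : k \;; f = 0 -> exists l, k = l \;; g.
Proof.
move=> kf; have [O O0] := zero_object_ex C.
have SO0 : idm (Sg O) = 0 by rewrite -fmap1 O0 fmap0.
have idB : dist T (0 : mor O B) (idm B) 0.
  by apply: (proj2 (dist_rot _ _ _)); rewrite fmap0 oppr0; apply: dist_id.
have sq : k \;; f = 0 \;; (0 : mor X O) by rewrite kf compm0.
by have [l [lg _]] := dist_fill fgh idB sq; exists l; rewrite lg comp1m.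
Qed.

End Exactness.

Lemma dist_comp0' X Y Z (f : mor X Y) (g : mor Y Z) (h : mor Z (Sg X)) :
  dist T f g h -> h \;; g = 0 /\ fmap Sg f \;; h = 0.
Proof.
move=> fgh; split; first exact: dist_comp0 (dist_rotl fgh).
apply/eqP; rewrite -oppr_eq0 -compNm; apply/eqP.
exact: dist_comp0 (dist_rotl (dist_rotl fgh)).
Qed.

(** Exactness at the suspended source, where the rotated triangle involves a
    sign. *)
Lemma dist_lift3 X Y Z (f : mor X Y) (g : mor Y Z) (h : mor Z (Sg X))
    A (k : mor A (Sg X)) :
  dist T f g h -> fmap Sg f \;; k = 0 -> exists l, k = h \;; l.
Proof.
move=> fgh fk; apply: (dist_lift (dist_rotl (dist_rotl fgh))).
by rewrite compNm fk oppr0.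
Qed.

Lemma dist_extend3 X Y Z (f : mor X Y) (g : mor Y Z) (h : mor Z (Sg X))
    B (k : mor (Sg X) B) :
  dist T f g h -> k \;; h = 0 -> exists l, k = l \;; fmap Sg f.
Proof.
move=> fgh kh.
have [l ->] := dist_extend (dist_rotl (dist_rotl fgh)) kh.
by exists (- l); rewrite compmN compNm.
Qed.

Lemma cofiber0_retract X Y Z : is_cofiber T (0 : mor X Y) Z ->
  exists (i : mor Y Z) (r : mor Z Y), r \;; i = idm Y.
Proof.
case=> i [h dh]; have [r ri] := dist_extend dh (compm0 X (idm Y)).
by exists i, r.
Qed.

(** The cofiber of a regular map [f : X -> Y], with [f g f = f], is a retract
    of [Y] plus the suspension of [X]: [1 - f g] kills [f], hence factors as
    [s q], and then [1 - q s] kills [q], hence factors as [t h]. *)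
Lemma cofiber_regular X Y Z (f : mor X Y) :
  regular f -> is_cofiber T f Z ->
  exists (q : mor Y Z) (s : mor Z Y) (t : mor (Sg X) Z) (h : mor Z (Sg X)),
    idm Z = q \;; s + t \;; h.
Proof.
case=> g fgf [q [h dh]].
have [|s sq] := dist_extend dh (k := idm Y - f \;; g).
  by rewrite compmBl comp1m fgf subrr.
have [|t th] := dist_extend (dist_rotl dh) (k := idm Z - q \;; s).
  rewrite compmBl comp1m -compmA -sq compmBr compm1 compmA (dist_comp0 dh).
  by rewrite comp0m subr0 subrr.
by exists q, s, t, h; rewrite -th addrC subrK.
Qed.

End Triangulated.

(** * The action of the ring of the unit *)

Section Action.
Variables (C : additiveCat) (M : closedSymMonoidal C).
Implicit Types X Y Z : C.
Local Notation S := (sunit M).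
Local Notation R := (unit_ring M).

Lemma curry_comp X Y Z W (f : mor (smash M Z X) Y) (g : mor W Z) :
  curry M f \;; g = curry M (f \;; smash_map M g (idm X)).
Proof.
rewrite -[LHS]evK -[in smash_map _ _ _](comp1m (idm X)) smash_map_comp.
by rewrite compmA curryK.
Qed.

Lemma curry_inj X Y Z (f g : mor (smash M Z X) Y) :
  curry M f = curry M g -> f = g.
Proof. by move=> fg; rewrite -[f]curryK fg curryK. Qed.

Lemma smash_map0l X X' Y : smash_map M (0 : mor X X') (idm Y) = 0.
Proof.
have [O O0] := zero_object_ex C.
rewrite -[0 in LHS](compm0 X (0 : mor O X')) -[in LHS](comp1m (idm Y)).
rewrite smash_map_comp [smash_map M (0 : mor O X') _](_ : _ = 0) ?comp0m //.
by apply: curry_inj; rewrite -[LHS]compm1 -[RHS]compm1 O0 !compm0.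
Qed.

(** Smashing with [Y] is a left adjoint, so a map out of [B /\ Y], for a
    biproduct [B], is determined by its restrictions to the two summands. *)
Lemma smash_mapDl X X' Y (f g : mor X X') :
  smash_map M (f + g) (idm Y) = smash_map M f (idm Y) + smash_map M g (idm Y).
Proof.
have sm1 A A' A'' (b : mor A' A'') (a : mor A A') :
    smash_map M (b \;; a) (idm Y) =
    smash_map M b (idm Y) \;; smash_map M a (idm Y).
  by rewrite -smash_map_comp comp1m.
have [B [i1 [i2 [p1 [p2 [p1i1 p2i2 p1i2 p2i1 idB]]]]]] := biproduct_ex X X.
have idBY : idm (smash M B Y) =
    smash_map M i1 (idm Y) \;; smash_map M p1 (idm Y)
    + smash_map M i2 (idm Y) \;; smash_map M p2 (idm Y).
  apply: curry_inj; rewrite -[LHS]compm1 -[RHS]compm1 -idB !compmDr !compmA.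
  congr (_ \;; p1 + _ \;; p2); rewrite !curry_comp comp1m; congr curry.
    by rewrite compmDl -!compmA -!sm1 p1i1 p2i1 compm1 compm0 smash_map0l addr0.
  by rewrite compmDl -!compmA -!sm1 p1i2 p2i2 compm1 compm0 smash_map0l add0r.
pose m := f \;; p1 + g \;; p2; pose d := i1 + i2.
have mi1 : m \;; i1 = f.
  by rewrite compmDl -!compmA p1i1 p2i1 compm1 compm0 addr0.
have mi2 : m \;; i2 = g.
  by rewrite compmDl -!compmA p1i2 p2i2 compm1 compm0 add0r.
have p1d : p1 \;; d = idm X by rewrite compmDr p1i1 p1i2 addr0.
have p2d : p2 \;; d = idm X by rewrite compmDr p2i1 p2i2 add0r.
have -> : f + g = m \;; d by rewrite compmDr mi1 mi2.
rewrite sm1 -[smash_map M d _]comp1m idBY compmDl compmDr.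
by rewrite -!compmA -!sm1 !compmA mi1 mi2 -!compmA p1d p2d !compm1.
Qed.

Lemma smash_mapDr X X' Y (f g : mor X X') :
  smash_map M (idm Y) (f + g) = smash_map M (idm Y) f + smash_map M (idm Y) g.
Proof.
have tw (h : mor X X') : smash_map M (idm Y) h =
    twist M X' Y \;; smash_map M h (idm Y) \;; twist M Y X.
  by rewrite twist_nat -compmA twistK compm1.
by rewrite !tw smash_mapDl compmDr compmDl.
Qed.

Definition act (r : R) X : mor X X :=
  fwd (runit M X) \;; smash_map M (idm X) r \;; bwd (runit M X).

Lemma act_nat r X Y (f : mor X Y) : act r Y \;; f = f \;; act r X.
Proof.
apply: (@comp_fwd_inj _ _ _ _ (runit M X)); rewrite /act.
rewrite -[_ \;; f \;; _]compmA -runit_nat -!compmA.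
rewrite [bwd (runit M Y) \;; _]compmA fwdK comp1m fwdK compm1.
rewrite -smash_map_comp [f \;; (_ \;; _)]compmA -runit_nat -!compmA.
by rewrite -smash_map_comp !comp1m !compm1.
Qed.

Lemma actD r s X : act (r + s) X = act r X + act s X.
Proof. by rewrite /act smash_mapDr compmDr compmDl. Qed.

Lemma act0 X : act 0 X = 0.
Proof. by apply: (addrI (act 0 X)); rewrite -actD !addr0. Qed.

Lemma actN r X : act (- r) X = - act r X.
Proof. by apply: (addrI (act r X)); rewrite -actD !subrr act0. Qed.

Lemma actM r s X : act (r * s) X = act r X \;; act s X.
Proof.
rewrite /act -!compmA [bwd _ \;; (fwd _ \;; _)]compmA fwdK comp1m.
by rewrite [smash_map M _ r \;; _]compmA -smash_map_comp comp1m.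
Qed.

Definition kills r X : Prop := act r X = 0.

Lemma kills_mul r s X : kills s X -> kills (r * s) X.
Proof. by rewrite /kills actM => ->; rewrite compm0. Qed.

Lemma kills_retract r X Y (i : mor X Y) (p : mor Y X) :
  p \;; i = idm X -> kills r Y -> kills r X.
Proof.
move=> pi rY; rewrite /kills -[act r X]compm1 -pi compmA act_nat rY.
by rewrite compm0 comp0m.
Qed.

Hypothesis Rcomm : commutative (@GRing.mul R).

(** [act r S] is the conjugate of [r] by the automorphism
    [fwd (runit S) \;; bwd (lunit S)] of the unit: commutativity of [R] makes
    this conjugation trivial, so that no coherence between the two unit
    isomorphisms is involved. *)
Lemma act_unit r : act r S = r.
Proof.
have comm (a b : mor S S) : a \;; b = b \;; a by apply: Rcomm.
pose u : mor S S := fwd (runit M S) \;; bwd (lunit M S).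
have -> : act r S = u \;; r \;; (fwd (lunit M S) \;; bwd (runit M S)).
  rewrite /act /u -!compmA; congr (_ \;; _); rewrite !compmA; congr (_ \;; _).
  apply: (@fwd_comp_inj _ _ _ _ (lunit M S)).
  by rewrite lunit_nat !compmA bwdK comp1m.
rewrite (comm u) -compmA /u -!compmA [bwd (lunit M S) \;; _]compmA fwdK comp1m.
by rewrite bwdK compm1.
Qed.

Lemma act_unitr r X (f : mor S X) : act r X \;; f = f \;; r.
Proof. by rewrite act_nat act_unit. Qed.

End Action.

(** * Thick subcategories and smash products *)

Section SmashTriangulated.
Variables (C : additiveCat) (T : triangulation C) (M : closedSymMonoidal C).
Variable compatTM : compatible T M.
Implicit Types X Y Z W A : C.
Local Notation S := (sunit M).
Local Notation R := (unit_ring M).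
Local Notation Sg := (susp T).

Lemma thick_iso A X Y (u : iso X Y) : thick T A X -> thick T A Y.
Proof. exact: thick_retract (bwdK u). Qed.

Lemma thick_trans A Z X : thick T A Z -> thick T Z X -> thick T A X.
Proof.
move=> AZ; elim=> {X} [|X _|X _|X Y i r ri _|X Y W f g h d _ + _
  |X Y W f g h d _ + _|X Y W f g h d _ + _]; first by [].
- exact: thick_susp.
- exact: thick_desusp.
- exact: thick_retract ri.
- exact: thick_dist1 d.
- exact: thick_dist2 d.
- exact: thick_dist3 d.
Qed.

Definition twist_iso X Y : iso (smash M X Y) (smash M Y X) :=
  Iso (twistK M X Y) (twistK M Y X).

Lemma smash_iso_id X X' Y Y' (f : mor X X') (f' : mor X' X) (g : mor Y Y')
    (g' : mor Y' Y) :
  f' \;; f = idm X -> g' \;; g = idm Y ->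
  smash_map M f' g' \;; smash_map M f g = idm (smash M X Y).
Proof. by move=> fK gK; rewrite -smash_map_comp fK gK smash_map1. Qed.

Definition smash_iso X X' Y Y' (u : iso X X') (v : iso Y Y') :
    iso (smash M X Y) (smash M X' Y') :=
  Iso (smash_iso_id (fwdK u) (fwdK v)) (smash_iso_id (bwdK u) (bwdK v)).

Definition smash_swap X Y Z :
    iso (smash M X (smash M Y Z)) (smash M Y (smash M X Z)) :=
  iso_trans (iso_sym (assoc M X Y Z))
    (iso_trans (smash_iso (twist_iso X Y) (iso_refl Z)) (assoc M Y X Z)).

Lemma thick_smashr A X W :
  thick T A X -> thick T (smash M A W) (smash M X W).
Proof.
elim=> {X} [|X _ XW|X _ XW|X Y i r ri _ YW|X Y Z f g h d _ + _
  |X Y Z f g h d _ + _|X Y Z f g h d _ + _]; first exact: thick_gen.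
- exact: thick_iso (iso_sym (smash_susp compatTM X W)) (thick_susp XW).
- pose u := iso_trans (iso_sym (smash_iso (suspK T X) (iso_refl W)))
    (smash_susp compatTM (desusp T X) W).
  exact: thick_iso (iso_trans (fmap_iso _ u) (desuspK T _)) (thick_desusp XW).
- by apply: thick_retract YW; apply: smash_iso_id ri (comp1m _).
- exact: thick_dist1 (smash_exact compatTM W d).
- exact: thick_dist2 (smash_exact compatTM W d).
- exact: thick_dist3 (smash_exact compatTM W d).
Qed.

Lemma thick_smashl A X W :
  thick T A X -> thick T (smash M W A) (smash M W X).
Proof.
move=> /(@thick_smashr _ _ W) /(thick_iso (twist_iso X W)).
apply: thick_trans; apply: (thick_iso (twist_iso W A)); exact: thick_gen.
Qed.

(** This is where the compatibility of the suspension with the right unit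
    enters. *)
Lemma act_susp (r : R) X : act r (Sg X) = fmap Sg (act r X).
Proof.
apply: (@comp_fwd_inj _ _ _ _ (runit M (Sg X))).
rewrite /act -[LHS]compmA fwdK compm1 -(smash_susp_runit compatTM) -compmA.
rewrite -[in smash_map _ _ r]fmap1 smash_susp_nat !compmA -!fmap_comp.
by rewrite -[_ \;; _ \;; fwd (runit M X)]compmA fwdK compm1.
Qed.

(** The triangle obtained by smashing on the right with [X] involves
    [r /\ X], whereas [act] is built from [X /\ r]: the twist relates them. *)
Lemma smash_cofiber (r : R) A X :
  is_cofiber T (r : mor S S) A -> is_cofiber T (act r X) (smash M A X).
Proof.
case=> g [h /(smash_exact compatTM X)] d.
pose u := iso_trans (twist_iso S X) (runit M X).
exists (smash_map M g (idm X) \;; bwd u).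
exists (fmap Sg (fwd u) \;; (fwd (smash_susp compatTM S X)
  \;; smash_map M h (idm X))).
apply: (dist_iso (u := u) (v := u) (w := iso_refl _) _ _ _ d) => /=.
- rewrite -compmA twist_nat /act !compmA -[_ \;; bwd _ \;; fwd _]compmA fwdK.
  by rewrite compm1.
- rewrite comp1m -compmA -(compmA (twist M X S)) (compmA (bwd (runit M X))).
  by rewrite fwdK comp1m twistK compm1.
- by rewrite compm1.
Qed.

Lemma smash_killed_retract (r : R) A X :
  is_cofiber T (r : mor S S) A -> kills r X ->
  exists (i : mor X (smash M A X)) (p : mor (smash M A X) X), p \;; i = idm X.
Proof.
by move=> /(smash_cofiber X) + rX; rewrite rX; apply: cofiber0_retract.
Qed.

(** [act r Z] factors through [h], where [act s] is zero.  A product is needed: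
    [2] annihilates the outer terms, but not the middle one, of the extension of
    [Z/2] by [Z/2] given by [Z/4]. *)
Lemma kills_dist (r s : R) X Y Z (f : mor X Y) (g : mor Y Z) h :
  dist T f g h -> act r Z \;; g = 0 -> h \;; act s Z = 0 ->
  kills (s * r) Z.
Proof.
move=> d rg hs; have [l lE] := dist_extend (dist_rotl d) rg.
by rewrite /kills actM lE compmA act_nat -compmA act_nat hs compm0.
Qed.

Lemma kills_cofiber (r s : R) X Y Z (f : mor X Y) :
  kills r X -> kills s Y -> is_cofiber T f Z -> kills (r * s) Z.
Proof.
move=> rX sY [g [h d]]; apply: (kills_dist d).
  by rewrite act_nat sY compm0.
by rewrite -act_nat act_susp rX fmap0 comp0m.
Qed.

Lemma kills_act_cofiber (r : R) X Z :
  is_cofiber T (act r X) Z -> kills (r * r) Z.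
Proof.
move=> [g [h d]]; apply: (kills_dist d).
  by rewrite act_nat (dist_comp0 d).
by rewrite -act_nat act_susp (dist_comp0' d).2.
Qed.

End SmashTriangulated.

(** * Retracts of finite sums of spheres *)

Section Spheres.
Variables (C : additiveCat) (T : triangulation C) (M : closedSymMonoidal C).
Implicit Types X Y Z A : C.
Local Notation S := (sunit M).
Local Notation R := (unit_ring M).
Local Notation Sg := (susp T).
Local Notation Sph i := (shift T i (sunit M)).

Lemma shift_susp (i : int) X : iso (Sg (shift T i X)) (shift T (i + 1) X).
Proof.
case: i => [n|[|n]].
- by rewrite -PoszD addn1; apply: iso_refl.
- exact: suspK.
- have -> : Negz n.+1 + 1 = Negz n by rewrite !NegzE -addn1 PoszD opprD addrNK.
  exact: (suspK T (shift T (Negz n) X)).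
Qed.

(** A property of pairs of objects that is invariant under isomorphisms and
    under simultaneous suspension can be tested on the pairs of spheres whose
    target is the unit. *)
Lemma sphere_pair_shift (Q : C -> C -> Prop) :
    (forall X X' Y Y', iso X X' -> iso Y Y' -> Q X Y -> Q X' Y') ->
    (forall X Y, Q (Sg X) (Sg Y) <-> Q X Y) ->
  forall i j : int, Q (Sph (i - j)) S -> Q (Sph i) (Sph j).
Proof.
move=> Qiso Qsusp.
have step i j : Q (Sph (i + 1)) (Sph (j + 1)) <-> Q (Sph i) (Sph j).
  split=> [q|/Qsusp]; last by apply: Qiso; apply: shift_susp.
  by apply/Qsusp; apply: Qiso q; apply: iso_sym; apply: shift_susp.
move=> i j; elim/int_rect: j i => [|n IH|n IH] i; first by rewrite subr0.
  rewrite -addn1 PoszD opprD addrA => q; rewrite -(subrK 1 i).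
  by apply/step/IH; rewrite -addrA [- 1 - _]addrC addrA.
by move=> q; apply/step; rewrite -addn1 PoszD opprD subrK; apply: IH;
  move: q; rewrite -addn1 PoszD opprK opprK addrA addrAC.
Qed.

Lemma hom_zero_shift (i : int) X :
  hom_zero (Sph (i + 1)) (Sg X) <-> hom_zero (Sph i) X.
Proof.
split=> [z|z].
  apply/(hom_zero_susp T).
  exact: hom_zero_iso (iso_sym (shift_susp i S)) (iso_refl _) z.
apply: hom_zero_iso (shift_susp i S) (iso_refl _) _.
exact: (proj2 (hom_zero_susp T _ _) z).
Qed.

Lemma hom_zero_iter (n : nat) (i : int) X :
  hom_zero (Sph i) X -> hom_zero (Sph (i + n)) (iter n Sg X).
Proof.
elim: n i => [|n IH] i; first by rewrite addr0.
by rewrite -addn1 PoszD addrA addn1 => /IH z; apply/hom_zero_shift.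
Qed.

Hypothesis Rconc : htpy_unit_concentrated T M.

Lemma hom_zero_spheres (i j : int) : i != j -> hom_zero (Sph i) (Sph j).
Proof.
move=> ij; apply: (sphere_pair_shift (Q := @hom_zero C)).
- by move=> X X' Y Y'; apply: hom_zero_iso.
- exact: hom_zero_susp.
- by apply: Rconc; rewrite subr_eq0.
Qed.

(** [spherical f] says that [f] factors through a finite sum of spheres, and
    [spherical (idm X)] that [X] is a retract of such a sum. *)
Inductive spherical X Y : mor X Y -> Prop :=
| spherical0 : spherical 0
| sphericalD f (k : int) (a : mor (Sph k) Y) (b : mor X (Sph k)) :
    spherical f -> spherical (f + a \;; b).

Lemma spherical_add X Y (f g : mor X Y) :
  spherical f -> spherical g -> spherical (f + g).
Proof.
move=> sf; elim=> [|g' k a b _ IH]; first by rewrite addr0.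
by rewrite addrA; apply: sphericalD.
Qed.

Lemma spherical_comp X X' Y Y' (h : mor X' X) (f : mor X Y) (g : mor Y Y') :
  spherical f -> spherical (g \;; f \;; h).
Proof.
elim=> [|f' k a b _ IH]; first by rewrite compm0 comp0m; apply: spherical0.
by rewrite compmDr compmDl !compmA -[_ \;; b \;; h]compmA; apply: sphericalD.
Qed.

Lemma spherical_susp X Y (f : mor X Y) : spherical f -> spherical (fmap Sg f).
Proof.
elim=> [|f' k a b _ IH]; first by rewrite fmap0; apply: spherical0.
rewrite fmapD fmap_comp; pose u := shift_susp k S.
rewrite -[fmap Sg b]comp1m -(fwdK u) -compmA compmA.
exact: sphericalD.
Qed.

Lemma spherical_id_susp X : spherical (idm X) -> spherical (idm (Sg X)).
Proof. by move/spherical_susp; rewrite fmap1. Qed.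

Lemma spherical_desusp X Y (f : mor X Y) :
  spherical f -> spherical (fmap (desusp T) f).
Proof.
elim=> [|f' k a b _ IH]; first by rewrite fmap0; apply: spherical0.
rewrite fmapD fmap_comp.
have u : iso (desusp T (Sph k)) (Sph (k - 1)).
  apply: iso_trans (desuspK T _); apply: fmap_iso.
  by have := iso_sym (shift_susp (k - 1) S); rewrite subrK.
rewrite -[fmap (desusp T) b]comp1m -(fwdK u) -compmA compmA.
exact: sphericalD.
Qed.

Lemma spherical_id_cofiber X Y Z (f : mor X Y) :
  spherical (idm X) -> spherical (idm Y) -> regular f -> is_cofiber T f Z ->
  spherical (idm Z).
Proof.
move=> sX sY rf /(cofiber_regular rf) [q [s [t [h ->]]]].
rewrite -[q]compm1 -[t]compm1; apply: spherical_add.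
  exact: spherical_comp.
exact/spherical_comp/spherical_id_susp.
Qed.

Lemma spherical_ghost X Y (f : mor X Y) :
  spherical (idm X) -> (forall i (a : mor (Sph i) X), f \;; a = 0) -> f = 0.
Proof.
move=> sX f0; rewrite -[f]compm1; elim: sX => [|g k a b _ IH].
  exact: compm0.
by rewrite compmDr IH compmA f0 comp0m addr0.
Qed.

(** * Regularity of the maps between retracts of sums of spheres *)

Variable compatTM : compatible T M.
Hypothesis Rcomm : commutative (@GRing.mul R).
Variable e : R.

Definition regular_pair X Y : Prop :=
  forall f : mor X Y, act e Y \;; f = 0 -> regular f.

Lemma killed_defect X Y (f : mor X Y) (g : mor Y X) :
  act e Y \;; f = 0 -> act e Y \;; (f - f \;; g \;; f) = 0.
Proof. by move=> ef; rewrite compmBr !compmA ef !comp0m subrr. Qed.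

Lemma regular_of_killed_defects X Y (f : mor X Y) (g : mor Y X) :
  f - f \;; g \;; f = 0 -> regular f.
Proof. by move/eqP; rewrite subr_eq0 => /eqP fgf; exists g. Qed.

(** The summands of the source are treated one at a time: correcting [f] by a
    pseudo-inverse of its restriction to a sphere makes the defect vanish on
    that sphere, and keeps it zero on the spheres already treated. *)
Lemma regular_pair_source X Y :
  spherical (idm X) -> (forall k, regular_pair (Sph k) Y) -> regular_pair X Y.
Proof.
move=> sX reg f ef.
suff [g] : exists g, (f - f \;; g \;; f) \;; idm X = 0.
  by rewrite compm1; apply: regular_of_killed_defects.
elim: sX => [|u k a b _ [g hu]]; first by exists 0; rewrite compm0.
set h := f - f \;; g \;; f in hu; have eh := killed_defect g ef.
have [|g1 hg1] := reg k (h \;; a); first by rewrite compmA eh comp0m.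
have [g' hE] := mccoy_defect f g (a \;; g1); exists g'; rewrite -hE -/h.
have h'a : (h - h \;; (a \;; g1) \;; h) \;; a = 0.
  by rewrite compmBl -[in X in X - _]hg1 !compmA subrr.
rewrite compmDr [_ \;; (a \;; b)]compmA h'a comp0m compmBl -compmA hu.
by rewrite compm0 subrr addr0.
Qed.

Lemma regular_pair_target X Y :
  spherical (idm Y) -> (forall k, regular_pair X (Sph k)) -> regular_pair X Y.
Proof.
move=> sY reg f ef.
suff [g] : exists g, idm Y \;; (f - f \;; g \;; f) = 0.
  by rewrite comp1m; apply: regular_of_killed_defects.
elim: sY => [|u k a b _ [g uh]]; first by exists 0; rewrite comp0m.
set h := f - f \;; g \;; f in uh; have eh := killed_defect g ef.
have [|g1 hg1] := reg k (b \;; h).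
  by rewrite compmA act_nat -compmA eh compm0.
have [g' hE] := mccoy_defect f g (g1 \;; b); exists g'; rewrite -hE -/h.
have bh' : b \;; (h - h \;; (g1 \;; b) \;; h) = 0.
  by rewrite compmBr -[in X in X - _]hg1 !compmA subrr.
rewrite compmDl -[a \;; b \;; _]compmA bh' compm0 compmBr !compmA uh.
by rewrite !comp0m subrr addr0.
Qed.

Hypothesis ee : e * e = e.
Hypothesis vnr : forall r : R, e * r = 0 -> exists s, r * s * r = r.

Lemma regular_pair_spheres i j : regular_pair (Sph i) (Sph j).
Proof.
apply: (sphere_pair_shift (Q := regular_pair)).
- move=> X X' Y Y' u v reg f ef; apply: (regular_iso (u := u) (v := v)).
  by apply: reg; rewrite !compmA act_nat -[_ \;; f]compmA ef compm0 comp0m.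
- move=> X Y; split=> reg f ef.
    by apply/(regular_susp T)/reg; rewrite act_susp // -fmap_comp ef fmap0.
  have [g fE] := susp_full f; rewrite fE; apply/regular_susp/reg.
  by apply: (susp_eq0 (T := T)); rewrite fmap_comp -act_susp // -fE.
- have [/eqP|ij] := eqVneq (i - j) 0; last first.
    by move=> f _; rewrite (Rconc ij f); apply: regular0.
  move/eqP=> -> f; rewrite act_unit // => /vnr [s fsf].
  by exists s.
Qed.

Lemma spherical_regular X Y (f : mor X Y) :
  spherical (idm X) -> spherical (idm Y) -> kills e Y -> regular f.
Proof.
move=> sX sY eY; suff reg : regular_pair X Y by apply: reg; rewrite eY comp0m.
apply: regular_pair_source => // k; apply: regular_pair_target => // l.
exact: regular_pair_spheres.
Qed.

Definition split_object X : Prop := spherical (idm X) /\ kills e X.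

(** [e] annihilates the cofiber because [e * e] does, and [e] is idempotent. *)
Lemma split_cofiber X Y Z (f : mor X Y) :
  split_object X -> split_object Y -> is_cofiber T f Z -> split_object Z.
Proof.
move=> [sX eX] [sY eY] fZ; split.
  exact: spherical_id_cofiber (spherical_regular f sX sY eY) fZ.
by rewrite -ee; apply: kills_cofiber fZ.
Qed.

Lemma split_retract X Y (i : mor X Y) (p : mor Y X) :
  p \;; i = idm X -> split_object Y -> split_object X.
Proof.
move=> pi [sY eY]; split; last exact: kills_retract pi eY.
by have := spherical_comp i p sY; rewrite compm1 pi.
Qed.

Lemma split_iso X Y (u : iso X Y) : split_object X -> split_object Y.
Proof. exact: split_retract (bwdK u). Qed.

Lemma split_susp X : split_object X -> split_object (Sg X).
Proof.
move=> [sX eX]; split; first exact: spherical_id_susp.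
by rewrite /kills act_susp // eX fmap0.
Qed.

Lemma split_desusp X : split_object X -> split_object (desusp T X).
Proof.
move=> [sX eX]; split; first by rewrite -fmap1; apply: spherical_desusp.
apply: (susp_eq0 (T := T)); rewrite -act_susp //.
exact: kills_retract (fwdK (suspK T X)) eX.
Qed.

Lemma split_thick A X : split_object A -> thick T A X -> split_object X.
Proof.
move=> GA; elim=> {X} [|X _|X _|X Y i p pi _|X Y Z f g h d _ GY _ GZ
  |X Y Z f g h d _ GX _ GZ|X Y Z f g h d _ GX _ GY] //.
- exact: split_susp.
- exact: split_desusp.
- exact: split_retract pi.
- apply: split_iso (desuspK T X) _; apply: split_desusp.
  apply: (split_cofiber (f := g) GY GZ).
  by exists h, (- fmap Sg f); apply: dist_rotl.
- apply: split_iso (desuspK T Y) _; apply: split_desusp.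
  apply: (split_cofiber (f := h) GZ (split_susp GX)).
  exists (- fmap Sg f), (- fmap Sg g).
  exact: (dist_rotl (dist_rotl d)).
- by apply: (split_cofiber (f := f) GX GY); exists g, h.
Qed.

End Spheres.

(** * Commutative algebra *)

Section CommutativeAlgebra.
Variable R : comPzRingType.
Implicit Types (r s x y : R) (xs ys : seq R).

Fixpoint ideal_span ys r : Prop :=
  if ys is y :: ys' then exists s, ideal_span ys' (r - y * s) else r = 0.

Lemma ideal_span0 ys : ideal_span ys 0.
Proof. by elim: ys => // y ys IH; exists 0; rewrite mulr0 subr0. Qed.

Lemma ideal_spanD ys r s :
  ideal_span ys r -> ideal_span ys s -> ideal_span ys (r + s).
Proof.
elim: ys r s => [|y ys IH] r s /=; first by move=> -> ->; rewrite addr0.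
move=> [a ra] [b sb]; exists (a + b).
by rewrite mulrDr opprD addrACA; apply: IH.
Qed.

Lemma ideal_spanM ys r s : ideal_span ys s -> ideal_span ys (r * s).
Proof.
elim: ys s => [|y ys IH] s /=; first by move=> ->; rewrite mulr0.
by move=> [a sa]; exists (r * a); rewrite mulrCA -mulrBr; apply: IH.
Qed.

Lemma mem_span ys y : y \in ys -> ideal_span ys y.
Proof.
elim: ys => // z ys IH; rewrite inE => /orP [/eqP ->|/IH hy].
  by exists 1; rewrite mulr1 subrr; apply: ideal_span0.
by exists 0; rewrite mulr0 subr0.
Qed.

Lemma ideal_span_ind ys (P : R -> Prop) :
  P 0 -> (forall r s, P r -> P s -> P (r + s)) ->
  (forall y s, y \in ys -> P (y * s)) -> forall r, ideal_span ys r -> P r.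
Proof.
move=> P0 PD; elim: ys => [|y ys IH] PM r /=; first by move=> ->.
move=> [s] /IH rs; rewrite -(subrK (y * s) r); apply: PD.
  by apply: rs => z t zys; apply: PM; rewrite inE zys orbT.
by apply: PM; rewrite inE eqxx.
Qed.

(** If an element of [L] whose products with the [x] in [xs] are all in [J] must
    be in [J], then powers of the [x] suffice: lower the exponents one by one,
    replacing [s] by [s * x].  This serves twice: for the zero ideal [J], to
    cancel the powers of the generators of an ideal that meets its annihilator
    trivially, and for the annihilator [J] of a Koszul object, to show that it
    contains an idempotent. *)
Lemma cancel_powers (L J : R -> Prop) xs :
    (forall s x, x \in xs -> L s -> L (s * x)) ->
    (forall s x, J s -> J (s * x)) ->
    (forall s, L s -> (forall x, x \in xs -> J (s * x)) -> J s) ->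
  forall s, L s -> (forall x, x \in xs -> exists m, J (s * x ^+ m)) -> J s.
Proof.
move=> Lx Jx cancel s Ls hs.
suff claim ys : {subset ys <= xs} -> forall s, L s ->
    (forall x, x \in ys -> exists m, J (s * x ^+ m)) ->
    (forall x, x \in xs -> x \notin ys -> J (s * x)) -> J s.
  by apply: (claim xs) => // x ->.
elim: ys {s Ls hs} => [|y ys IH] sub s Ls.
  by move=> _ hs; apply: cancel => // x xxs; apply: hs.
have yxs : y \in xs by apply: sub; rewrite inE eqxx.
have {}sub : {subset ys <= xs}.
  by move=> x xys; apply: sub; rewrite inE xys orbT.
move=> pow; have [m] := pow y (mem_head y ys).
have {}pow x : x \in ys -> exists m, J (s * x ^+ m).
  by move=> xys; apply: pow; rewrite inE xys orbT.
elim: m s Ls pow => [|m IHm] s Ls pow Jm out; first by rewrite -[s]mulr1.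
have Jsy : J (s * y).
  apply: IHm; first exact: Lx.
  - by move=> x /pow [k Jk]; exists k; rewrite mulrAC; apply: Jx.
  - by rewrite -mulrA -exprS.
  - by move=> x xxs xys; rewrite mulrAC; apply/Jx/out.
apply: IH => // x xxs xys; have [-> //|xy] := eqVneq x y.
by apply: out; rewrite // inE negb_or xy.
Qed.

(** Nakayama's lemma, by elimination of the generators one at a time: [1 - e]
    multiplies the ideal into the span of the remaining generators. *)
Lemma idempotent_generator xs :
    (forall P : R -> Prop, P 0 -> (forall r s, P r -> P s -> P (r + s)) ->
       (forall r s, ideal_span xs r -> ideal_span xs s -> P (r * s)) ->
     forall z, ideal_span xs z -> P z) ->
  exists e, ideal_span xs e /\ forall z, ideal_span xs z -> (1 - e) * z = 0.
Proof.
move=> sq.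
suff claim ys : {subset ys <= xs} ->
    (exists e, ideal_span xs e /\
       forall z, ideal_span xs z -> ideal_span ys ((1 - e) * z)) ->
    exists e, ideal_span xs e /\ forall z, ideal_span xs z -> (1 - e) * z = 0.
  apply: (claim xs) => //; exists 0; split; first exact: ideal_span0.
  by move=> z; rewrite subr0 mul1r.
elim: ys => // y ys IH sub [e [xe he]]; apply: IH.
  by move=> z zys; apply: sub; rewrite inE zys orbT.
pose Q z := exists b, ideal_span xs b /\ ideal_span ys ((1 - e) * z - b * y).
have [b [xb hb]] : Q y.
  apply: (sq Q).
  - by exists 0; rewrite mulr0 mul0r subr0; split; apply: ideal_span0.
  - move=> r s [b [xb rb]] [c [xc sc]]; exists (b + c).
    split; first exact: ideal_spanD.
    by rewrite mulrDr [(b + c) * y]mulrDl opprD addrACA; apply: ideal_spanD.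
  - move=> r s /he [d rd] xs_s; exists (d * s); split; first exact: ideal_spanM.
    have -> : (1 - e) * (r * s) - d * s * y = s * ((1 - e) * r - y * d) by ring.
    exact: ideal_spanM.
  - by apply/mem_span/sub; rewrite inE eqxx.
exists (1 - (1 - e - b) * (1 - e)); split.
  have -> : 1 - (1 - e - b) * (1 - e) = e + (1 - e) * (e + b) by ring.
  by apply: ideal_spanD => //; apply/ideal_spanM/ideal_spanD.
move=> z /he [d zd]; rewrite subKr -mulrA.
have -> : (1 - e - b) * ((1 - e) * z) =
    (1 - e - b) * ((1 - e) * z - y * d) + d * ((1 - e) * y - b * y).
  by ring.
by apply: ideal_spanD; apply: ideal_spanM.
Qed.

End CommutativeAlgebra.

(** * Koszul objects *)

Section Koszul.
Variables (C : additiveCat) (T : triangulation C) (M : closedSymMonoidal C).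
Variable compatTM : compatible T M.
Implicit Types X Y Z A K : C.
Local Notation S := (sunit M).
Local Notation R := (unit_ring M).
Local Notation Sg := (susp T).
Local Notation Sph i := (shift T i (sunit M)).
Implicit Types (xs ys : seq R).

(** [koszul ys K] says that [K] is [S/y1 /\ (S/y2 /\ ...)], for some choice of
    the cofibers.  Relating rather than choosing them lets the same predicate
    cover the given cofibers and those obtained from the axioms. *)
Inductive koszul : seq R -> C -> Prop :=
| koszul_nil : koszul [::] S
| koszul_cons (y : R) ys A Z :
    is_cofiber T (y : mor S S) A -> koszul ys Z ->
    koszul (y :: ys) (smash M A Z).

Lemma koszul_bigop (J : Type) (s : seq J) (x : J -> R) (Sx : J -> C) :
  (forall j, is_cofiber T (x j : mor S S) (Sx j)) ->
  koszul (map x s) (\big[smash M/S]_(j <- s) Sx j).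
Proof.
move=> cof; elim: s => [|j s IH]; first by rewrite big_nil; apply: koszul_nil.
by rewrite big_cons; apply: koszul_cons.
Qed.

(** [y * y] annihilates the cofiber of [y], and each further cofiber at most
    doubles the exponent, because it is an extension of two objects annihilated
    by the same power. *)
Lemma koszul_killed_powers ys K y :
  koszul ys K -> y \in ys -> exists m, kills (y ^+ m) K.
Proof.
elim=> {ys K} // z ys A Z cof _ IH; have cofZ := smash_cofiber compatTM Z cof.
rewrite inE => /orP [/eqP ->|/IH [m ym]].
  by exists 2; rewrite expr2; exact: (kills_act_cofiber compatTM cofZ).
by exists (m + m)%N; rewrite exprD; exact: (kills_cofiber compatTM ym ym cofZ).
Qed.

(** The octahedron on [x x : S -> S] presents [S/x^2] as an extension of [S/x]
    by itself. *)
Lemma thick_cofiber_sq (x : R) A B Z :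
  is_cofiber T (x : mor S S) A -> is_cofiber T (x * x : mor S S) B ->
  thick T (smash M A Z) (smash M B Z).
Proof.
move=> /(smash_cofiber compatTM Z) [g [h d]] /(smash_cofiber compatTM Z).
rewrite actM => -[p [q d2]].
have [u [v [d3 _]]] := dist_octahedron d d d2.
exact: thick_dist2 d3 (thick_gen _ _) (thick_gen _ _).
Qed.

Lemma koszul_sq xs K : koszul xs K ->
  exists K', koszul [seq x * x | x <- xs] K' /\ thick T K K'.
Proof.
elim=> {xs K} [|x xs A Z cof _ [Z' [kos ZZ']]].
  by exists S; split; [apply: koszul_nil | apply: thick_gen].
have [B [p [q d]]] := dist_cone T (x * x : mor S S).
have cofB : is_cofiber T (x * x : mor S S) B by exists p, q.
exists (smash M B Z'); split; first exact: koszul_cons.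
apply: thick_trans (thick_smashl compatTM A ZZ') _.
exact: thick_cofiber_sq cof cofB.
Qed.

(** The version of [ideal_span] for the [R]-module of maps from [X] to [Y]; the
    recursion on [ys] follows the construction of a Koszul object. *)
Fixpoint act_span X Y ys (g : mor X Y) : Prop :=
  if ys is y :: ys' then exists g', act_span ys' (g - act y Y \;; g')
  else g = 0.

Lemma act_span_post X Y Z ys (k : mor Y Z) (g : mor X Y) :
  act_span ys g -> act_span ys (k \;; g).
Proof.
elim: ys g => [|y ys IH] g /=; first by move=> ->; rewrite compm0.
move=> [g' gs]; exists (k \;; g').
by rewrite compmA act_nat -compmA -compmBr; apply: IH.
Qed.

Lemma act_span_susp X Y ys (g : mor X Y) :
  act_span ys (fmap Sg g) <-> act_span ys g.
Proof.
elim: ys g => [|y ys IH] g /=; first by split=> [/susp_eq0|->] //; apply: fmap0.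
split=> -[g'].
  have [k ->] := susp_full g'.
  by rewrite act_susp // -fmap_comp -fmapB IH; exists k.
by rewrite -IH fmapB fmap_comp -act_susp //; exists (fmap Sg g').
Qed.

Lemma act_span_iter X Y ys n (g : mor X Y) :
  act_span ys (fmap_iter T n g) <-> act_span ys g.
Proof. by elim: n => //= n IH; rewrite act_span_susp. Qed.

Hypothesis Rcomm : commutative (@GRing.mul R).
Hypothesis Rconc : htpy_unit_concentrated T M.

(** The ring of the unit with commutativity packed into its structure, so that
    the lemmas on commutative rings apply to it. *)
Definition unit_comring : comPzRingType :=
  HB.pack_for comPzRingType R (GRing.PzRing_hasCommutativeMul.Build R Rcomm).

Lemma act_spanE ys (r : R) :
  act_span ys (r : mor S S) <-> ideal_span (ys : seq unit_comring) r.
Proof.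
elim: ys r => [|y ys IH] r //=.
by split=> -[s rs]; exists s; move: rs; rewrite act_unit // IH.
Qed.

(** The bottom cell [q] presents [pi_0 K] as the quotient of [R] by the ideal of
    [ys], and [K] has no homotopy below degree zero. *)
Lemma koszul_bottom ys K : koszul ys K ->
  [/\ forall i : int, i < 0 -> hom_zero (Sph i) K
    & exists q : mor S K, (forall h : mor S K, exists r, h = q \;; r) /\
        (forall r : mor S S, q \;; r = 0 -> act_span ys r)].
Proof.
elim=> {ys K} [|y ys A Z cof _ [neg [q [qsurj qker]]]].
  split=> [i i0|]; first by apply: Rconc; apply: ltr0_neq0.
  by exists (idm S); split=> r; [exists r|]; rewrite comp1m.
have [g [h d]] := smash_cofiber compatTM Z cof.
have vanish i : i <= 0 -> hom_zero (Sph i) (Sg Z).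
  move=> i0; rewrite -(subrK 1 i); apply/hom_zero_shift/neg.
  by rewrite ltrBlDr add0r (le_lt_trans i0).
have lift i (a : mor (Sph i) (smash M A Z)) : i <= 0 -> exists b, a = g \;; b.
  by move=> i0; apply: (dist_lift (dist_rotl d)); apply: vanish.
split=> [i i0 a|].
  by have [b ->] := lift i a (ltW i0); rewrite (neg i i0 b) compm0.
exists (g \;; q); split=> [a|r].
  have [b ->] := lift 0 a (lexx 0); have [r ->] := qsurj b.
  by exists r; rewrite compmA.
rewrite -compmA => /(dist_lift d) [b]; have [r' ->] := qsurj b => qr /=.
exists r'; apply: qker; rewrite compmBr qr act_unit // !compmA act_nat.
by rewrite act_unit // subrr.
Qed.

(** Dually, maps from [K] to an object [Y] without homotopy below the dimension
    of the top cell of [K] are the maps from that cell, modulo the multiples of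
    the entries of [ys]. *)
Lemma koszul_top ys K : koszul ys K ->
  exists delta : mor K (Sph (size ys)),
  forall Y, (forall j : nat, (j < size ys)%N -> hom_zero (Sph j) Y) ->
    (forall h : mor K Y, exists g, h = g \;; delta) /\
    (forall g : mor (Sph (size ys)) Y, g \;; delta = 0 -> act_span ys g).
Proof.
elim=> {ys K} [|y ys A Z cof _ [delta top]].
  exists (idm S) => Y _; split=> [h|g]; first by exists h; rewrite compm1.
  by rewrite compm1.
have [g [h d]] := smash_cofiber compatTM Z cof.
exists (fmap Sg delta \;; h) => Y /= vanish.
pose Y' := desusp T Y; pose u : iso (Sg Y') Y := suspK T Y.
have [onto' ker'] : (forall k : mor Z Y', exists l, k = l \;; delta) /\
    (forall l : mor (Sph (size ys)) Y', l \;; delta = 0 -> act_span ys l).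
  apply: top => j jn; apply/(hom_zero_susp T).
  exact: hom_zero_iso (iso_refl _) (iso_sym u) (vanish j.+1 jn).
have susp_hom X (k : mor (Sg X) Y) :
    exists l : mor X Y', k = fwd u \;; fmap Sg l.
  have [l lE] := susp_full (bwd u \;; k); exists l.
  by rewrite -lE compmA bwdK comp1m.
have onto (k : mor (Sg Z) Y) : exists l, k = l \;; fmap Sg delta.
  have [k' ->] := susp_hom _ k; have [l ->] := onto' k'.
  by exists (fwd u \;; fmap Sg l); rewrite fmap_comp compmA.
split=> [k|k].
  have kg0 : k \;; g = 0.
    have [|onto0 _] := top Y; first by move=> j jn; apply: vanish; apply: ltnW.
    have [l ->] := onto0 (k \;; g).
    by rewrite (vanish _ (ltnSn _) l) comp0m.
  have [k' ->] := dist_extend (dist_rotl d) kg0.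
  by have [l ->] := onto k'; exists l; rewrite compmA.
rewrite compmA => /(dist_extend3 d) [k']; have [l ->] := onto k' => kl.
exists l; have [m mE] := susp_hom _ (k - act y Y \;; l).
rewrite mE; apply: act_span_post; apply/act_span_susp; apply: ker'.
apply: (susp_eq0 (T := T)); apply: (@fwd_comp_inj _ _ _ _ u).
rewrite fmap_comp compm0 compmA -mE compmBl kl -act_susp //.
by rewrite -act_nat compmA subrr.
Qed.

End Koszul.

(** * Ghosts on Koszul objects *)

Section Ghosts.
Variables (C : additiveCat) (T : triangulation C) (M : closedSymMonoidal C).
Variable compatTM : compatible T M.
Hypothesis Rcomm : commutative (@GRing.mul (unit_ring M)).
Hypothesis Rconc : htpy_unit_concentrated T M.
Implicit Types X Y Z A E K : C.
Local Notation S := (sunit M).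
Local Notation R := (unit_ring M).
Local Notation CR := (unit_comring Rcomm).
Local Notation Sg := (susp T).
Local Notation Sph i := (shift T i (sunit M)).
Local Notation gh A := (generating_hypothesis T M (thick T A)).
Implicit Types (xs ys : seq CR).

Lemma gh_thick A B : thick T A B -> gh A -> gh B.
Proof. by move=> AB ghA X Y f BX BY; apply: ghA; apply: thick_trans AB _. Qed.

Lemma thick_iter_susp n A X : thick T A X -> thick T A (iter n Sg X).
Proof. by move=> AX; elim: n => //= n; apply: thick_susp. Qed.

Lemma act_iter_susp n (r : R) X : act r (iter n Sg X) = fmap_iter T n (act r X).
Proof. by elim: n => //= n <-; rewrite act_susp. Qed.

(** The map [K -> S^n -> S^n -> Sigma^n K] is the collapse onto the top cell,
    followed by [c] and by the inclusion of the bottom cell.  On homotopy groups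
    it can be nonzero only in degree [n], where the image of the collapse is
    annihilated by powers of the entries of [ys]; and it vanishes only if [c]
    lies in the ideal generated by [ys]. *)
Lemma koszul_ghost ys K (c : CR) :
  koszul T ys K -> gh K ->
  (forall r : CR, (forall y, y \in ys -> exists m, y ^+ m * r = 0) ->
     c * r = 0) ->
  ideal_span ys c.
Proof.
move=> kos ghK ann_c.
have [neg [q [qsurj qker]]] := koszul_bottom compatTM Rcomm Rconc kos.
have [delta top] := koszul_top compatTM kos.
set n := size ys in delta top.
have f0 : fmap_iter T n (q \;; c) \;; delta = 0.
  apply: ghK; [exact: thick_gen | exact/thick_iter_susp/thick_gen | move=> i a].
  rewrite -compmA.
  have [ni|/(hom_zero_spheres Rconc) z] := eqVneq i n; last first.
    by rewrite (z (delta \;; a)) compm0.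
  move: a; rewrite ni => a.
  have [r dr] := fmap_iter_full (T := T) (delta \;; a).
  rewrite dr -fmap_iter_comp; apply/fmap_iter_eq0; rewrite -compmA.
  rewrite [c \;; r](_ : _ = 0) ?compm0 //; apply: ann_c => y yys.
  have [m ym] := koszul_killed_powers compatTM kos yys; exists m.
  apply/(fmap_iter_eq0 T n); rewrite [LHS]fmap_iter_comp -dr.
  rewrite -{1}[y ^+ m](act_unit Rcomm) -act_iter_susp compmA act_nat ym.
  by rewrite compm0 comp0m.
have [|_ ker] := top (iter n Sg K).
  move=> j jn; rewrite -(subrK (n : int) (j : int)).
  by apply/hom_zero_iter/neg; rewrite subr_lt0 ltz_nat.
have lift zs (h : mor S K) : act_span zs h ->
    exists d : CR, ideal_span (zs : seq CR) d /\ h = q \;; d.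
  elim: zs h => [|z zs IH] h /=; first by move=> ->; exists 0; rewrite compm0.
  move=> [h']; have [r ->] := qsurj h' => /IH [d [zd hd]].
  exists (d + z * r : CR); split; first by exists r; rewrite addrK.
  by rewrite compmDr -hd compmA (act_unitr Rcomm) -compmA subrK.
(* hence [q \;; c = q \;; d] for some [d] in the ideal of [ys] *)
have [d [yd qd]] := lift ys _ (proj1 (act_span_iter compatTM _ _ _) (ker _ f0)).
rewrite -(subrK d c); apply: ideal_spanD yd.
by apply/act_spanE/qker; rewrite compmBr qd subrr.
Qed.

(** The ghost is taken on the Koszul object of the squares, whose homotopy is
    still annihilated by powers of the entries of [xs]. *)
Lemma koszul_gh_sq xs K :
  koszul T xs K -> gh K ->
  (forall r : CR, ideal_span xs r -> (forall x, x \in xs -> r * x = 0) ->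
     r = 0) ->
  forall c : CR, ideal_span xs c -> ideal_span [seq x * x | x <- xs] c.
Proof.
move=> kos ghK reduced c xc.
have [K' [kos' KK']] := koszul_sq compatTM kos.
apply: koszul_ghost kos' (gh_thick KK' ghK) _ => r r0.
apply: (cancel_powers (L := ideal_span xs) (J := fun s => s = 0) (xs := xs)).
- by move=> s x _ xs_s; rewrite mulrC; apply: ideal_spanM.
- by move=> s x ->; rewrite mul0r.
- exact: reduced.
- by rewrite mulrC; apply: ideal_spanM.
move=> x xxs; have [|m xm] := r0 (x * x); first exact: map_f.
exists (m + m)%N; rewrite exprD -exprMn -mulrA [r * _]mulrC.
by rewrite [_ * r](_ : _ = 0) ?mulr0.
Qed.

Lemma koszul_gh_idempotent xs K :
  koszul T xs K -> gh K ->
  (forall r : CR, ideal_span xs r -> (forall x, x \in xs -> r * x = 0) ->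
     r = 0) ->
  exists e : CR, ideal_span xs e /\
    forall z : CR, ideal_span xs z -> (1 - e) * z = 0.
Proof.
move=> kos ghK reduced; apply: idempotent_generator => P P0 PD PM z.
move/(koszul_gh_sq kos ghK reduced); apply: ideal_span_ind => // y s.
move=> /mapP [x xxs ->]; rewrite -mulrA; apply: PM; first exact: mem_span.
by rewrite mulrC; apply/ideal_spanM/mem_span.
Qed.

(** For [r] in the ideal of [y] annihilated by [y], multiplication by [r] on
    [Sigma S] lifts to [b : Sigma S -> A], and the composite of [b] with the
    collapse [h : A -> Sigma S] is zero on homotopy, because [h] identifies
    [pi_1 A] with the annihilator of [y].  If it is zero, [b] extends along
    [y], so that [r] is [y] times an element annihilated by [y]. *)
Lemma cofiber_gh_reduced (y : CR) A :
  is_cofiber T (y : mor S S) A -> gh A ->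
  forall s : CR, y * (y * s) = 0 -> y * s = 0.
Proof.
move=> [g [h d]] ghA s yys.
have [|b hb] := dist_lift3 (k := fmap Sg (y * s : mor S S)) d.
  by rewrite -fmap_comp [y \;; _](_ : _ = 0) ?fmap0.
have hinj u : hom_zero (Sg S) S -> h \;; u = 0 -> u = 0 :> mor (Sg S) A.
  by move=> z /(dist_lift (dist_rotl d)) [k ->]; rewrite (z k) compm0.
have S10 : hom_zero (Sg S) S.
  by apply: (hom_zero_spheres Rconc (i := 1) (j := 0)).
have ann (k : mor (Sg S) A) : exists2 u : CR, h \;; k = fmap Sg u & y * u = 0.
  have [u hu] := susp_full (h \;; k); exists u => //.
  apply: (susp_eq0 (T := T)); rewrite [LHS]fmap_comp -hu compmA.
  by rewrite (dist_comp0' d).2 comp0m.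
have bh0 : b \;; h = 0.
  apply: ghA; [exact: thick_gen | exact: thick_gen | move=> i a].
  rewrite -compmA.
  have [i1|/(hom_zero_spheres Rconc) z] := eqVneq i 1; last first.
    by rewrite (z (h \;; a)) compm0.
  move: a; rewrite i1 => a; have [u hu yu] := ann a; rewrite hu.
  apply: hinj => //; rewrite compmA -hb -fmap_comp.
  have -> : (y * s : mor S S) \;; u = y * s * u :> CR by [].
  by rewrite mulrAC yu mul0r fmap0.
have [k bk] := dist_extend3 d bh0; have [u hu yu] := ann k.
rewrite -yu [RHS]mulrC; apply: (@susp_inj _ T).
by rewrite hb bk compmA hu -fmap_comp.
Qed.

(** * The part of the unit complementary to an idempotent *)

Section Idempotent.
Variables (e : CR) (E : C).
Hypothesis ee : e * e = e.
Hypothesis cofE : is_cofiber T (e : mor S S) E.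

(** An idempotent of the ideal of [xs] is a combination of arbitrarily large
    powers of the entries of [xs], and some of these powers annihilate [K]. *)
Lemma koszul_killed_idempotent xs K :
  koszul T xs K -> ideal_span xs e -> kills e K.
Proof.
move=> kos xe.
apply: (cancel_powers (L := fun s => e * s = s) (J := fun s => kills s K)
  (xs := xs : seq CR)) ee _.
- by move=> s x _ es; rewrite mulrA es.
- by move=> s x sK; rewrite mulrC; apply: kills_mul.
- move=> s es xK; rewrite -es.
  apply: (ideal_span_ind (P := fun r => kills (r * s) K)) xe.
  + by rewrite mul0r /kills act0.
  + move=> r t; rewrite /kills mulrDl actD => -> ->; exact: addr0.
  + move=> x t xxs; rewrite mulrAC mulrC; apply: kills_mul.
    by rewrite mulrC; apply: xK.
move=> x xxs; have [m xm] := koszul_killed_powers compatTM kos xxs.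
by exists m; apply: kills_mul.
Qed.

Lemma kills_smash_idempotent Z : kills e (smash M E Z).
Proof.
rewrite -ee.
exact: (kills_act_cofiber compatTM (smash_cofiber compatTM Z cofE)).
Qed.

(** As [x = e * x], the generator [x] annihilates [E /\ Z], which is then a
    retract of [A /\ (E /\ Z)] for the cofiber [A] of [x]. *)
Lemma thick_smash_idempotent xs K :
  koszul T xs K -> (forall x, x \in xs -> e * x = x) ->
  thick T (smash M E K) E.
Proof.
move=> kos ex.
suff thE : thick T (smash M E K) (smash M E S).
  exact: thick_iso (runit M E) thE.
elim: kos ex => {xs K} [|x xs A Z cofA _ IH] ex; first exact: thick_gen.
have xE : kills x (smash M E Z).
  rewrite -(ex x) ?mem_head // mulrC; apply: kills_mul.
  exact: kills_smash_idempotent.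
have [i [p pi]] := smash_killed_retract compatTM cofA xE.
apply: thick_trans (IH _); last first.
  by move=> z zxs; apply: ex; rewrite inE zxs orbT.
apply: thick_retract pi _; apply: thick_iso (smash_swap M E A Z) _.
exact: thick_gen.
Qed.

Lemma thick_act_cofiber (r : R) X Z : is_cofiber T (act r X) Z -> thick T X Z.
Proof. by move=> [g [h d]]; apply: thick_dist3 d _ _; apply: thick_gen. Qed.

Lemma thick_idempotent xs K :
  koszul T xs K -> (forall x, x \in xs -> e * x = x) -> thick T K E.
Proof.
move=> kos ex; apply: thick_trans (thick_smash_idempotent kos ex).
exact: thick_act_cofiber (smash_cofiber compatTM K cofE).
Qed.

(** [e = e * (y * y)] annihilates the cofiber [A] of [y], which is therefore a
    retract of [E /\ A], the cofiber of [y] on [E]. *)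
Lemma thick_cofiber_multiple y A :
  e * y = e -> is_cofiber T (y : mor S S) A -> thick T E A.
Proof.
move=> ey cofA.
have eA : kills e A.
  have -> : e = e * (y * y) by rewrite mulrA !ey.
  apply: kills_mul; apply: (kills_act_cofiber compatTM (X := S)).
  by rewrite act_unit.
have [i [p pi]] := smash_killed_retract compatTM cofE eA.
apply: thick_retract pi _; apply: thick_iso (twist_iso M A E) _.
exact: thick_act_cofiber (smash_cofiber compatTM E cofA).
Qed.

(** Replacing [x] by [y = e + (1 - e) x] makes the cofiber of [y] an object
    annihilated by [e], without changing [x] modulo [e]. *)
Lemma idempotent_gh_regular xs K :
  koszul T xs K -> gh K -> (forall x, x \in xs -> e * x = x) ->
  forall x : CR, exists s t : CR, x * s * x - x = e * t.
Proof.
move=> kos ghK ex x; pose y := e + (1 - e) * x.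
have [A [g [h d]]] := dist_cone T (y : mor S S).
have cofA : is_cofiber T (y : mor S S) A by exists g, h.
have ghA : gh A.
  apply: gh_thick ghK; apply: thick_trans (thick_idempotent kos ex) _.
  apply: thick_cofiber_multiple cofA.
  by rewrite mulrDr ee mulrA mulrBr mulr1 ee subrr mul0r addr0.
have kosA : koszul T [:: y] (smash M A S) by apply/koszul_cons/koszul_nil.
have ghAS : gh (smash M A S).
  apply: gh_thick ghA; apply: thick_iso (iso_sym (runit M A)) _.
  exact: thick_gen.
have [|s] := koszul_gh_sq kosA ghAS _ (mem_span (mem_head y [::])).
  move=> r [s /eqP]; rewrite subr_eq0 => /eqP -> /(_ y (mem_head _ _)).
  by rewrite mulrC; apply: cofiber_gh_reduced cofA ghA s.
rewrite /= => /eqP; rewrite subr_eq0 => /eqP yE; exists s.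
(* here [x = y + e (x - 1)], while [y y s = y] *)
pose w := x - 1; exists (w * s * y + y * s * w + e * (w * s * w) - w).
apply: (@eq_trans _ _ (y * y * s - y
    + e * (w * s * y + y * s * w + e * (w * s * w) - w))).
  by rewrite /w /y; ring.
by rewrite -yE subrr add0r.
Qed.

Hypothesis vnr : forall r : R, e * r = 0 -> exists s, r * s * r = r.

(** [e] is its own pseudo-inverse. *)
Lemma split_idempotent : split_object T (e : R) E.
Proof.
have sS : spherical T M (idm S).
  have := @sphericalD _ T M S S 0 0 (idm S) (idm S) (spherical0 _ _ _ _).
  by rewrite add0r comp1m.
have cofE' : is_cofiber T (act e S) E by rewrite act_unit.
split; last by rewrite -ee; apply: (kills_act_cofiber compatTM cofE').
have rege : regular (act e S).
  have e2 : e \;; e = e := ee; by rewrite act_unit //; exists e; rewrite !e2.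
exact: (spherical_id_cofiber sS sS rege cofE').
Qed.

(** The retract [K] of [E /\ K] is reached from [E] by adjoining the generators
    after [E], one cofiber at a time, so that all the intermediate objects are
    annihilated by [e]. *)
Lemma split_koszul xs K :
  koszul T xs K -> kills e K -> split_object T (e : R) K.
Proof.
move=> kos eK; have [i [p pi]] := smash_killed_retract compatTM cofE eK.
apply: (split_retract pi); elim: kos {eK i p pi} => [|y ys A Z cofA _ IH].
  exact: split_iso (iso_sym (runit M E)) split_idempotent.
apply: split_iso (smash_swap M A E Z) _.
exact: (split_cofiber Rconc compatTM Rcomm ee vnr IH IH
  (smash_cofiber compatTM _ cofA)).
Qed.

End Idempotent.
End Ghosts.

Lemma von_neumann_regular_quot (R : pzRingType) (I : ideal R) :
  von_neumann_regular (ring_quot I) <->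
  forall x : R, exists y, I (x * y * x - x).
Proof.
pose p (r : R) : ring_quot I := (\pi r)%qT.
have pM r s : p r * p s = p (r * s) by apply: ring_quot_mulE.
have pP r s : I (r - s) <-> p r = p s by apply: eq_ring_quot.
have pS q : exists r, q = p r by exists (repr q); rewrite /p reprK.
have pMM r s : p r * p s * p r = p (r * s * r).
  by rewrite (pM r s) (pM (r * s) r).
split=> vnr => [r|q].
  have [q] := vnr (p r); have [s ->] := pS q.
  by rewrite pMM => /pP; exists s.
have [r ->] := pS q; have [s /pP rsr] := vnr r.
by exists (p s); rewrite pMM.
Qed.

Theorem theorem4p8 (D : additiveCat) (T : triangulation D)
    (M : closedSymMonoidal D) (compatTM : compatible T M)
    (coprodD : has_coproducts D)
    (Rcomm : commutative (@GRing.mul (unit_ring M)))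
    (Rconc : htpy_unit_concentrated T M)
    (I : ideal (unit_ring M))
    (n : nat) (x : 'I_n -> unit_ring M) (Igen : generated_by I x)
    (Iann : forall r : unit_ring M, I r -> annihilator I r -> r = 0)
    (Sx : 'I_n -> D)
    (Sx_cof : forall i : 'I_n,
      is_cofiber T (x i : mor (sunit M) (sunit M)) (Sx i)) :
  let SI := \big[smash M/sunit M]_(i < n) Sx i in
  generating_hypothesis T M (thick T SI) <->
  ring_direct_factor I /\ von_neumann_regular (ring_quot I).
Proof.
move=> SI; pose CR := unit_comring Rcomm.
pose xs : seq CR := [seq x i | i <- index_enum 'I_n].
have kos : koszul T xs SI by apply: koszul_bigop.
have xsP (y : CR) : y \in xs -> exists i, y = x i.
  by case/mapP=> i _ ->; exists i.
have memI i : I (x i).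
  apply/Igen; exists (fun j => (i == j)%:R).
  rewrite (bigD1 i) //= eqxx mul1r big1 ?addr0 // => j ji.
  by rewrite eq_sym (negPf ji) mul0r.
have spanI (r : CR) : I r <-> ideal_span xs r.
  split=> [/Igen [a ->]|].
    apply: (big_ind (fun r : CR => ideal_span xs r)) => [||i _].
    - exact: ideal_span0.
    - exact: ideal_spanD.
    - by apply: (@ideal_spanM CR); apply/mem_span/map_f; rewrite mem_index_enum.
  apply: ideal_span_ind; [exact: Defs.ideal0 | exact: Defs.idealD | move=> y s].
  by case/xsP=> i ->; apply: Defs.idealMr (memI i).
split=> [ghSI|[[e [ee Ie]] /von_neumann_regular_quot vnr]].
  have [e [xe ez]] : exists e : CR, ideal_span xs e /\
      forall z : CR, ideal_span xs z -> (1 - e) * z = 0.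
    apply: (koszul_gh_idempotent compatTM Rconc kos ghSI) => r /spanI Ir rx.
    apply: Iann => // y /spanI.
    apply: (ideal_span_ind (P := fun z : CR => r * z = 0)).
    - exact: mulr0.
    - by move=> a b ra rb; rewrite mulrDr ra rb addr0.
    - by move=> a b /rx ra; rewrite mulrA [_ * a]ra mul0r.
  have ez' (z : CR) : ideal_span xs z -> e * z = z.
    by move/ez/eqP; rewrite mulrBl mul1r subr_eq0 => /eqP <-.
  have ee := ez' e xe.
  split.
    exists e; split=> // r; split=> [/spanI /ez' er|[s ->]]; first by exists r.
    by apply/Defs.idealMr/spanI.
  have [E [g [h d]]] := dist_cone T (e : mor (sunit M) (sunit M)).
  have cofE : is_cofiber T (e : mor (sunit M) (sunit M)) E by exists g, h.
  apply/von_neumann_regular_quot=> a.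
  have [|s [t st]] := idempotent_gh_regular compatTM Rconc ee cofE kos ghSI _ a.
    by move=> y /mem_span /ez'.
  by exists s; rewrite [_ - _]st; apply/Defs.idealMr/spanI.
have vnr_e (r : CR) : e * r = 0 -> exists s : CR, r * s * r = r.
  move=> er; have [s /Ie [t rsr]] := vnr r; exists s.
  have : (1 - e) * (r * s * r - r) = 0 :> CR.
    by rewrite [r * s * r - r]rsr mulrA mulrBl mul1r [e * e]ee subrr mul0r.
  rewrite mulrBl mul1r mulrBr !mulrA er !mul0r subr0 subr0.
  by move/eqP; rewrite subr_eq0 => /eqP.
have xe : ideal_span xs e by apply/spanI/Ie; exists 1; rewrite mulr1.
have ex (y : CR) : y \in xs -> e * y = y.
  case/xsP=> i ->; have /Ie [s ->] := memI i.
  by rewrite mulrA [e * e]ee.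
have eSI := koszul_killed_idempotent compatTM ee kos xe.
have [E [g [h d]]] := dist_cone T (e : mor (sunit M) (sunit M)).
have cofE : is_cofiber T (e : mor (sunit M) (sunit M)) E by exists g, h.
have splitSI := split_koszul compatTM Rconc ee cofE vnr_e kos eSI.
move=> X Y f SIX _ f0; apply: spherical_ghost f0.
exact: (split_thick Rconc compatTM Rcomm ee vnr_e splitSI SIX).1.
Qed.
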